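(* Assume (A1) and (A2). (i) There exist two positive constants $c_1, c_2$ such that \[ c_1\sum_{\lambda\in\Lambda}|a_{\lambda}|^2 \le \int_{\Omega}\Big|\sum_{\lambda\in\Lambda}a_{\lambda}e^{i(\lambda,x)}\Big|^2\, dx \le c_2\sum_{\lambda\in\Lambda}|a_{\lambda}|^2 \] for all square summable families $(a_{\lambda})_{\lambda\in\Lambda}$ of complex coefficients. (ii) The two-sided estimates of part (i) fail if we remove any non-empty open subset from $\Omega$ (i.e., if $\Omega$ is replaced by $\Omega\setminus\omega$ for some non-empty open set $\omega$).
   Context: Let $u_1,\ldots,u_M\in\mathbb R^N$ be such that the $M$ translates $u_j+\mathbb Z^N$ are pairwise disjoint. Let $\Omega_0:=(0,2\pi)^N$. Let $v_1,\ldots,v_M\in\mathbb R^N$ satisfy the two conditions: (A1) the coordinates of each $v_k$ are multiples of $2\pi$; (A2) the matrix $E:=\left(e^{i(u_j,v_k)}\right)_{j,k=1}^M$ is invertible. Set $\Omega_k:=v_k+\Omega_0$ for $k=1,\ldots,M$. Fix an invertible linear transformation $L$ of $\mathbb R^N$ (with adjoint $L^*$), and define the lattice $\Lambda:=\bigcup_{j=1}^M L^*\left(u_j+\mathbb Z^N\right)\subset\mathbb R^N$ and the set $\Omega:=L^{-1}\left(\Omega_1\cup\cdots\cup\Omega_M\right)\subset\mathbb R^N$. Here $(\cdot,\cdot)$ is the standard inner product on $\mathbb R^N$. *)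

(* Defs.v *)
From HB Require Import structures.
From mathcomp Require Import all_boot all_order all_algebra.
From mathcomp Require Import all_classical all_reals all_analysis.
From mathcomp Require Import complex.

Set Implicit Arguments.
Unset Strict Implicit.
Unset Printing Implicit Defensive.

Import Order.TTheory GRing.Theory Num.Theory.
Local Open Scope classical_set_scope.
Local Open Scope ring_scope.

(* Points of R^N are represented as N.-tuple R (which carries the product
   sigma-algebra in MathComp-Analysis). *)

Section Defs.
Variables (R : realType) (N : nat).
Local Notation T := (N.-tuple R).

Definition dotN (x y : T) : R := \sum_(i < N) tnth x i * tnth y i.

Definition mxact (A : 'M[R]_N) (x : T) : T := [tuple \sum_(j < N) A i j * tnth x j | i < N].

Definition taddN (x y : T) : T := [tuple tnth x i + tnth y i | i < N].
Definition tsubN (x y : T) : T := [tuple tnth x i - tnth y i | i < N].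

Definition int_translate (u : T) : set T :=
  [set y | exists k : N.-tuple int, y = [tuple tnth u i + (tnth k i)%:~R | i < N]].

Definition expi (t : R) : R[i] := (cos t +i* sin t)%C.

Definition cnorm2 (z : R[i]) : R := (complex.Re z) ^+ 2 + (complex.Im z) ^+ 2.

Definition Omega0 : set T := [set x | forall i : 'I_N, 0 < tnth x i < 2 * pi].

Definition is_openN (w : set T) : Prop :=
  forall x, w x -> exists2 r : R, 0 < r &
    forall y : T, (forall i : 'I_N, `|tnth y i - tnth x i| < r) -> w y.

(* mu is the Lebesgue measure of R^N: it gives each open box its volume
   (this determines it uniquely on the product sigma-algebra) *)
Definition is_lebesgue_measureN (mu : {measure set T -> \bar R}) : Prop :=
  forall a b : T, (forall i : 'I_N, tnth a i <= tnth b i) ->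
    mu [set x | forall i : 'I_N, tnth a i < tnth x i < tnth b i] =
    (\prod_(i < N) (tnth b i - tnth a i))%:E.

Definition sqsum (Lam : set T) (a : T -> R[i]) : \bar R :=
  (\esum_(l in Lam) (cnorm2 (a l))%:E)%E.

Definition square_summable (Lam : set T) (a : T -> R[i]) : Prop :=
  (sqsum Lam a < +oo)%E.

Definition exp_partial_sum (F : set T) (a : T -> R[i]) (x : T) : R[i] :=
  \sum_(l \in F) a l * expi (dotN l x).

(* f is the sum, in L^2(D, mu), of the (unconditionally convergent) series
   sum_{lambda in Lam} a_lambda e^{i(lambda, x)}: f is measurable on D and
   the finite partial sums converge to f in L^2(D) along the net of finite
   subsets of Lam. *)
Definition L2_exp_sum (mu : {measure set T -> \bar R}) (D Lam : set T)
    (a : T -> R[i]) (f : T -> R[i]) : Prop :=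
  [/\ measurable_fun D (fun x => complex.Re (f x)),
      measurable_fun D (fun x => complex.Im (f x)) &
      forall e : R, 0 < e -> exists2 F0 : set T, finite_set F0 /\ F0 `<=` Lam &
        forall F : set T, finite_set F -> F0 `<=` F -> F `<=` Lam ->
          (\int[mu]_(x in D) (cnorm2 (f x - exp_partial_sum F a x))%:E < e%:E)%E].

Definition two_sided_estimate (mu : {measure set T -> \bar R}) (D Lam : set T)
    (c1 c2 : R) : Prop :=
  forall a : T -> R[i], square_summable Lam a ->
  forall f : T -> R[i], L2_exp_sum mu D Lam a f ->
    (c1%:E * sqsum Lam a <= \int[mu]_(x in D) (cnorm2 (f x))%:E)%E /\
    (\int[mu]_(x in D) (cnorm2 (f x))%:E <= c2%:E * sqsum Lam a)%E.

Definition Lambda (M : nat) (L : 'M[R]_N) (u : 'I_M -> T) : set T :=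
  [set l | exists j : 'I_M, exists y, int_translate (u j) y /\ l = mxact L^T y].

Definition Omega (M : nat) (L : 'M[R]_N) (v : 'I_M -> T) : set T :=
  [set x | exists k : 'I_M, Omega0 (tsubN (mxact L x) (v k))].

End Defs.

(* Main.v *)
(* Pushing the measure forward by L reduces everything to L = 1. The image measure
   need not be computed: only its translation invariance, its finiteness on bounded
   sets and its non-triviality matter. Invariance makes the integral of a
   2 pi-periodic function over the period cube insensitive to shifts, and shifting by
   pi / |m_i| along the i-th axis changes the sign of e^{i(m, x)}; hence the characters
   are orthogonal on the cube.

   At v_k + z, with z in (0, 2 pi)^N, the sum equals, by (A1),
   sum_j E_jk e^{i(u_j, z)} g_j(z), where g_j is the periodic sum of the coefficients
   attached to u_j. Since E is invertible, the sum over k of the squared moduli is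
   comparable to sum_j |g_j(z)|^2, and Parseval's identity gives the two-sided bounds
   for finite sums; the general case follows by completeness of L^2.

   For (ii), let v_k0 + z0 be a point of the image of the removed set and P a
   trigonometric polynomial concentrated at z0. With
   alpha_j = (E^-1)_{k0 j} e^{-i(u_j, z0)} the sum (sum_j alpha_j e^{i(u_j, x)}) P(x)
   is small in L^2 away from v_k0 + z0, because the first factor vanishes at v_k + z0
   for k <> k0, while its coefficients have norm comparable to that of P. *)
Require Import Defs.
From HB Require Import structures.
From mathcomp Require Import all_boot all_order all_algebra.
From mathcomp Require Import all_classical all_reals all_analysis.
From mathcomp Require Import complex.
From mathcomp Require Import measurable_realfun.
From mathcomp Require Import ring lra zify.
Import Order.TTheory GRing.Theory Num.Theory.
Import numFieldNormedType.Exports.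
Local Open Scope classical_set_scope.
Local Open Scope ring_scope.

Set Implicit Arguments.
Unset Strict Implicit.
Unset Printing Implicit Defensive.

(** [two_sided_estimate] speaks of every function that is an L^2 sum of the given family, so it
    would hold vacuously for a family without a sum; the completeness argument therefore has to
    produce a sum as well as bound it. All comparisons use squared moduli, with |z + w|^2 <= 2 |z|^2
    + 2 |w|^2 in place of the triangle inequality. This is why the constants for finite sums lose a
    factor 2 on each side in the limit.

    For (ii) it is the lower estimate that is contradicted. The first factor is small only near the
    points v_k + z0 with k <> k0 and merely bounded elsewhere, so two kinds of smallness must be
    combined, in this order. A bound [eta] for the first factor is fixed as a suitable fraction of
    the assumed constant; it determines a neighbourhood of z0; only then is P taken as a high power
    of a fixed polynomial, so that outside the neighbourhood it is exponentially small compared with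
    its total mass. P is never normalised: both sides are measured against the same integral
    [I2 n]. *)

(** * Open boxes as a generating pi-system *)

Section Boxes.
Variables (R : realType) (N : nat).
Local Notation T := (N.-tuple R).
Implicit Types (x y a b t : T) (A w : set T).

Definition open_box a b : set T :=
  [set x | forall i : 'I_N, tnth a i < tnth x i < tnth b i].

Definition open_boxes : set (set T) :=
  [set A | exists a b, (forall i, tnth a i <= tnth b i) /\ A = open_box a b].

Lemma eq_tnthP x y : (forall i, tnth x i = tnth y i) -> x = y.
Proof. exact: eq_from_tnth. Qed.

Lemma open_boxes_setI : setI_closed open_boxes.
Proof.
move=> _ _ [a [b [ab ->]]] [c [d [cd ->]]].
pose lo := [tuple Num.max (tnth a i) (tnth c i) | i < N].
pose hi := [tuple Num.min (tnth b i) (tnth d i) | i < N].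
have boxI : open_box a b `&` open_box c d = open_box lo hi.
  apply/seteqP; split => x /=.
    move=> [xab xcd] i; rewrite !tnth_mktuple gt_max lt_min.
    by have /andP[-> ->] := xab i; have /andP[-> ->] := xcd i.
  move=> h; split=> i; have := h i; rewrite !tnth_mktuple gt_max lt_min.
    by move=> /andP[/andP[-> _] /andP[-> _]].
  by move=> /andP[/andP[_ ->] /andP[_ ->]].
rewrite boxI; have [le|] := pselect (forall i, tnth lo i <= tnth hi i).
  by exists lo, hi.
move=> /existsNP[i /negP]; rewrite -ltNge => lt_i.
(* Crossed bounds in the coordinate [i] make the intersection empty, and the existence of [i] makes
   [open_box a a] empty too. *)
exists a, a; split => //; apply/seteqP; split => x /= => [/(_ i)|/(_ i)].
  by move=> /andP[/lt_trans h /h]; rewrite ltNge (ltW lt_i).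
by move=> /andP[/lt_trans h /h]; rewrite ltxx.
Qed.

Lemma measurable_open_box a b : measurable (open_box a b).
Proof.
have -> : open_box a b = \bigcap_(i in [set: 'I_N])
    ((@tnth N R)^~ i @^-1` `]tnth a i, tnth b i[%classic).
  apply/seteqP; split=> [x xab i _|x h i]; first by rewrite /= in_itv /=; exact: xab.
  by have := h i I; rewrite /= in_itv.
apply: fin_bigcap_measurable => // i _.
by rewrite -[X in measurable X]setTI; apply: measurable_tnth.
Qed.

Definition cube (r : R) : set T :=
  open_box [tuple - r | i < N] [tuple r | i < N].

Lemma cubeE r x : cube r x <-> forall i, `|tnth x i| < r.
Proof.
by split=> h i; have := h i; rewrite !tnth_mktuple ltr_norml.
Qed.

Lemma bigcup_cube : \bigcup_n cube n%:R = [set: T].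
Proof.
apply/seteqP; split => // x _.
exists (\sum_(i < N) Num.Def.truncn `|tnth x i|).+1 => //; apply/cubeE => i.
apply: lt_le_trans (truncnS_gt _) _; rewrite ler_nat ltnS.
by rewrite (bigD1 i) //= leq_addr.
Qed.

(** The product sigma-algebra is generated by coordinate half-spaces, and each of these is a
    countable union of open boxes. This lets a measure be identified by its values on boxes. *)
Lemma measurable_open_boxes : @measurable _ T = <<s open_boxes >>.
Proof.
apply/seteqP; split; last first.
  apply: smallest_sub; first exact: sigma_algebra_measurable.
  by move=> _ [a [b [_ ->]]]; exact: measurable_open_box.
have mt (i : 'I_N) : measurable_fun [set: g_sigma_algebraType open_boxes]
    ((fun x => @tnth N R x i) : g_sigma_algebraType open_boxes -> R).
  apply: (measurability (@RGenOInfty.G R)); first exact: RGenOInfty.measurableE.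
  move=> _ [_ [c ->] <-]; rewrite setTI.
  pose lo n := [tuple if j == i then c else - (n%:R : R) | j < N].
  (* The maximum keeps the bounds ordered when [n] is below [c]; the box is then empty. *)
  pose hi n := [tuple if j == i then Num.max c n%:R else (n%:R : R) | j < N].
  have -> : (fun x => @tnth N R x i) @^-1` `]c, +oo[%classic =
      \bigcup_n open_box (lo n) (hi n).
    apply/seteqP; split=> x /=; rewrite in_itv /= andbT.
      move=> cx; have : [set: T] x by [].
      rewrite -bigcup_cube => -[n _ /cubeE xn]; exists n => // j.
      rewrite !tnth_mktuple; case: eqP => [->|_]; last by rewrite -ltr_norml.
      by rewrite cx lt_max (le_lt_trans (ler_norm _) (xn i)) orbT.
    by move=> [n _ /(_ i)]; rewrite !tnth_mktuple eqxx => /andP[].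
  apply: bigcupT_measurable => n; apply: sub_sigma_algebra.
  exists (lo n), (hi n); split=> // j; rewrite !tnth_mktuple.
  by case: ifP => _; rewrite ?le_max ?lexx // ge0_cp // ler0n.
apply: smallest_sub; first exact: smallest_sigma_algebra.
move=> A; rewrite -bigcup_seq => -[i _ [B mB <-]].
exact: mt.
Qed.

(** An open set is the union of the cubes with rational centre and radius 1 / (n + 1) that it
    contains, and there are countably many of these. *)
Lemma measurable_openN w : is_openN w -> measurable w.
Proof.
move=> ow.
pose ball (p : N.-tuple rat * nat) : set T :=
  [set y | forall i, `|tnth y i - ratr (tnth p.1 i)| < p.2.+1%:R^-1].
have mball p : measurable (ball p).
  have -> : ball p = open_box [tuple ratr (tnth p.1 i) - p.2.+1%:R^-1 | i < N]
      [tuple ratr (tnth p.1 i) + p.2.+1%:R^-1 | i < N].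
    by apply/seteqP; split => y h i; have := h i;
      rewrite !tnth_mktuple ltr_distl.
  exact: measurable_open_box.
have -> : w = \bigcup_p (if `[< ball p `<=` w >] then ball p else set0).
  apply/seteqP; split => [x wx|x [p _]]; last first.
    by case: asboolP => // + xp; exact.
  have [r r0 hr] := ow _ wx.
  (* If the centre is within 1 / (n + 1) of [x], the whole cube is within 2 / (n + 1) of [x]. *)
  have [n] : exists n : nat, 2 * n.+1%:R^-1 < r.
    exists (Num.truncn (2 / r)).
    by rewrite ltr_pdivrMr // -ltr_pdivrMl // mulrC truncnS_gt.
  have n0 : (0 : R) < n.+1%:R^-1 by rewrite invr_gt0.
  move=> nr.
  have hq i : exists q : rat, `|tnth x i - ratr q| < n.+1%:R^-1.
    have lt_xi : tnth x i - n.+1%:R^-1 < tnth x i + n.+1%:R^-1.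
      by rewrite ltrD2l gtrN.
    have [q] := rat_in_itvoo lt_xi.
    by rewrite in_itv /= -ltr_distl distrC => h; exists q.
  have [q qP] := choice hq.
  exists ([tuple q i | i < N], n) => //.
  case: asboolP => [_|[]]; first by move=> i /=; rewrite tnth_mktuple.
  move=> y yq; apply: hr => i; move: n0 nr (yq i) (qP i).
  rewrite /= tnth_mktuple !ltr_distl; move: (n.+1%:R^-1) (ratr _) => e z.
  by move=> ? ? /andP[? ?] /andP[? ?]; apply/andP; split; lra.
apply: countable_bigcupT_measurable => [|p]; first exact: countableP.
by case: ifP.
Qed.

End Boxes.
Arguments cube {R} N r.

(** The pushforward is a measure only in the presence of the measurability proof; the existential
    hides that proof and leaves a variable of measure type. *)
Lemma image_measure_exists (d1 d2 : measure_display) (X : measurableType d1)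
    (Y : measurableType d2) (R : realType) (mu : {measure set X -> \bar R})
    (f : X -> Y) : measurable_fun setT f ->
  exists nu : {measure set Y -> \bar R},
    (nu : set Y -> \bar R) = pushforward mu f.
Proof.
by move=> mf; unshelve eexists (pushforward mu f : {measure set Y -> \bar R}).
Qed.

(** * Linear maps, translations and images of the Lebesgue measure *)

Section LinearMaps.
Variables (R : realType) (N : nat).
Local Notation T := (N.-tuple R).
Implicit Types (x y t : T) (A : set T).

Definition vaxis (i : 'I_N) (s : R) : T := [tuple if j == i then s else 0 | j < N].

Lemma tnth_taddN x y i : tnth (taddN x y) i = tnth x i + tnth y i.
Proof. exact: tnth_mktuple. Qed.

Lemma tnth_tsubN x y i : tnth (tsubN x y) i = tnth x i - tnth y i.
Proof. exact: tnth_mktuple. Qed.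

Lemma tnth_mxact (L : 'M[R]_N) x i :
  tnth (mxact L x) i = \sum_(j < N) L i j * tnth x j.
Proof. exact: tnth_mktuple. Qed.

Lemma tnth_vaxis i s j : tnth (vaxis i s) j = if j == i then s else 0.
Proof. exact: tnth_mktuple. Qed.

Lemma measurable_tnth_fun (D : set T) i :
  measurable_fun D (fun x : T => tnth x i).
Proof. by apply: measurable_funTS; exact: measurable_tnth. Qed.

Lemma measurable_taddN t : measurable_fun [set: T] (fun x => taddN x t).
Proof.
apply/measurable_fun_tnthP => i.
rewrite (_ : _ \o _ = fun x => tnth x i + tnth t i); last first.
  by apply/funext => x /=; rewrite tnth_taddN.
by apply: measurable_funD => //; exact: measurable_tnth_fun.
Qed.

Lemma measurable_mxact (L : 'M[R]_N) : measurable_fun [set: T] (mxact L).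
Proof.
apply/measurable_fun_tnthP => i.
rewrite (_ : _ \o _ = fun x => \sum_(j < N) L i j * tnth x j); last first.
  by apply/funext => x /=; rewrite tnth_mxact.
apply: measurable_sum => j.
by apply: measurable_funM => //; exact: measurable_tnth_fun.
Qed.

Lemma mxactM (A B : 'M[R]_N) x : mxact A (mxact B x) = mxact (A *m B) x.
Proof.
apply: eq_tnthP => i; rewrite !tnth_mxact.
under eq_bigr do rewrite tnth_mxact mulr_sumr.
rewrite exchange_big /=; apply: eq_bigr => j _.
by rewrite mxE mulr_suml; apply: eq_bigr => k _; rewrite mulrA.
Qed.

Lemma mxact1 x : mxact 1%:M x = x.
Proof.
apply: eq_tnthP => i; rewrite tnth_mxact (bigD1 i) //= big1.
  by rewrite mxE eqxx mul1r addr0.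
by move=> j ji; rewrite mxE eq_sym (negbTE ji) mul0r.
Qed.

Lemma mxactD (A : 'M[R]_N) x y : mxact A (taddN x y) = taddN (mxact A x) (mxact A y).
Proof.
apply: eq_tnthP => i; rewrite tnth_taddN !tnth_mxact -big_split /=.
by apply: eq_bigr => j _; rewrite tnth_taddN mulrDr.
Qed.

Lemma mxactK (L : 'M[R]_N) : L \in unitmx -> cancel (mxact L) (mxact (invmx L)).
Proof. by move=> Lu x; rewrite mxactM mulVmx // mxact1. Qed.

Lemma dotN_mxact (L : 'M[R]_N) x y : dotN (mxact L^T x) y = dotN x (mxact L y).
Proof.
rewrite /dotN; under eq_bigr do rewrite tnth_mxact mulr_suml.
rewrite exchange_big /=; apply: eq_bigr => j _.
by rewrite tnth_mxact mulr_sumr; apply: eq_bigr => i _; rewrite mxE; ring.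
Qed.

Definition shift_invariant (nu : {measure set T -> \bar R}) :=
  forall t A, measurable A -> nu ((fun x => taddN x t) @^-1` A) = nu A.

(** A translate of a box is a box of the same volume, and the boxes form a pi-system containing an
    exhausting sequence of finite measure, so the two measures agree everywhere. *)
Lemma lebesgue_shift_invariant (mu : {measure set T -> \bar R}) :
  is_lebesgue_measureN mu -> shift_invariant mu.
Proof.
move=> muL t A mA; have [nu nuE] := image_measure_exists mu (measurable_taddN t).
transitivity (nu A); first by rewrite nuE.
apply/esym; apply: (measure_unique (@open_boxes R N) (fun n => cube N n%:R)) => //.
- exact: measurable_open_boxes.
- exact: open_boxes_setI.
- move=> n; eexists; eexists; split; last reflexivity.
  by move=> i; rewrite !tnth_mktuple ge0_cp ?ler0n.
- exact: bigcup_cube.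
- move=> _ [a [b [ab ->]]]; rewrite nuE /pushforward.
  have -> : (fun x => taddN x t) @^-1` open_box a b =
      open_box (tsubN a t) (tsubN b t).
    apply/seteqP; split=> x h i; have := h i;
      by rewrite !tnth_tsubN !tnth_taddN ltrBlDr ltrBrDr.
  rewrite !muL // => [|i]; last by rewrite !tnth_tsubN lerB.
  by congr (_%:E); apply: eq_bigr => i _; rewrite !tnth_tsubN; ring.
- move=> n; rewrite muL ?ltry // => i.
  by rewrite !tnth_mktuple ge0_cp ?ler0n.
Qed.

(* The properties of the Lebesgue measure that survive a linear change of
   variables, and the only ones the argument uses. *)
Definition haarlike (nu : {measure set T -> \bar R}) :=
  [/\ shift_invariant nu, forall r, (nu (cube N r) < +oo)%E & nu setT != 0%E].

Lemma haarlike_image (mu nu : {measure set T -> \bar R}) (L : 'M[R]_N) :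
    is_lebesgue_measureN mu -> L \in unitmx ->
    (nu : set T -> \bar R) = pushforward mu (mxact L) -> haarlike nu.
Proof.
move=> muL Lu nuE; have mL := measurable_mxact L; split.
- move=> t A mA; rewrite nuE /pushforward.
  have mLA : measurable (mxact L @^-1` A) by rewrite -[X in measurable X]setTI; apply: mL.
  (* Since L x + t = L (x + L^-1 t), a shift of the image measure is a shift of [mu]. *)
  rewrite -(lebesgue_shift_invariant muL (mxact (invmx L) t) mLA).
  congr (mu _); apply/seteqP; split=> x /=;
    by rewrite mxactD mxactM mulmxV // mxact1.
- move=> r; rewrite nuE /pushforward.
  (* The double sum bounds the coordinates of L^-1 y for y in the cube; the added 1 gives the strict
     inequality of an open cube. *)
  pose r' : R := 1 + \sum_(i < N) \sum_(j < N) `|invmx L i j| * `|r|.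
  have r'0 : 0 <= r' by rewrite addr_ge0 // sumr_ge0 // => i _; rewrite sumr_ge0.
  have sub : mxact L @^-1` cube N r `<=` cube N r'.
    move=> x /cubeE Lx; apply/cubeE => i.
    rewrite -[x](mxactK Lu) tnth_mxact; apply: le_lt_trans (ler_norm_sum _ _ _) _.
    rewrite /r' [X in _ < 1 + X](bigD1 i) //=; set s := \sum_(k < N | k != i) _.
    have s0 : 0 <= s by rewrite sumr_ge0 // => k _; rewrite sumr_ge0.
    have : \sum_(j < N) `|invmx L i j * tnth (mxact L x) j| <=
        \sum_(j < N) `|invmx L i j| * `|r|.
      apply: ler_sum => j _; rewrite normrM ler_wpM2l //.
      exact: le_trans (ltW (Lx j)) (ler_norm _).
    by move=> /le_lt_trans; apply; rewrite ltr_pwDl // lerDl.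
  apply: le_lt_trans (_ : mu (cube N r') < +oo)%E.
    apply: le_measure => //; rewrite inE; last exact: measurable_open_box.
    by rewrite -[X in measurable X]setTI; apply: mL => //; exact: measurable_open_box.
  rewrite muL ?ltry // => i.
  by rewrite !tnth_mktuple ge0_cp.
- rewrite nuE /pushforward preimage_setT.
  pose o : T := [tuple 0 | i < N]; pose e : T := [tuple 1 | i < N].
  have : (mu (open_box o e) <= mu setT)%E.
    by apply: le_measure => //; rewrite inE //; exact: measurable_open_box.
  rewrite muL => [|i]; last by rewrite !tnth_mktuple ler01.
  rewrite big1 => [|i _]; last by rewrite !tnth_mktuple subr0.
  by apply: contraTneq => ->; rewrite lee_fin -ltNge ltr01.
Qed.

End LinearMaps.

(** * Half-open cubes, whose translates tile the space, and consequences of shift invariance *)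

Section HalfOpen.
Variables (R : realType) (N : nat).
Local Notation T := (N.-tuple R).

Definition half_open_cube (s : R) : set T :=
  [set x | forall i, 0 <= tnth x i < s].

Lemma measurable_half_open_cube s : measurable (half_open_cube s).
Proof.
have -> : half_open_cube s =
    \bigcap_(i in [set: 'I_N]) ((@tnth N R)^~ i @^-1` `[0, s[%classic).
  apply/seteqP; split=> [x xab i _|x h i]; first by rewrite /= in_itv /=; exact: xab.
  by have := h i I; rewrite /= in_itv.
apply: fin_bigcap_measurable => // i _.
by rewrite -[X in measurable X]setTI; apply: measurable_tnth.
Qed.
End HalfOpen.
Arguments half_open_cube {R} N s.

Section Haarlike.
Variables (R : realType) (N : nat).
Local Notation T := (N.-tuple R).
Variable nu : {measure set T -> \bar R}.
Hypothesis nuH : haarlike nu.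
Implicit Types (x y t : T) (A D : set T).

Let nuS : shift_invariant nu. Proof. by case: nuH. Qed.
Let nuF r : (nu (cube N r) < +oo)%E. Proof. by case: nuH. Qed.
Let nu0 : nu setT != 0%E. Proof. by case: nuH. Qed.

Lemma measurable_shift t A : measurable A -> measurable ((fun x => taddN x t) @^-1` A).
Proof. by move=> mA; rewrite -[X in measurable X]setTI; exact: measurable_taddN. Qed.

Lemma measurable_hyperplane (i : 'I_N) (c : R) : measurable [set x : T | tnth x i = c].
Proof.
rewrite (_ : mkset _ = [set: T] `&` (fun x => tnth x i) @^-1` [set c]).
  exact: measurable_tnth_fun.
by rewrite setTI; apply/seteqP; split.
Qed.

(* Infinitely many disjoint translates of a bounded piece of the hyperplane fit
   into one cube. *)
Lemma hyperplane_null (i : 'I_N) (c : R) : nu [set x | tnth x i = c] = 0%E.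
Proof.
set H := [set x | _]; have mH : measurable H by exact: measurable_hyperplane.
have HE : H = \bigcup_n (H `&` cube N n%:R) by rewrite -setI_bigcupr bigcup_cube setIT.
have mHc n : measurable (H `&` cube N n%:R).
  by apply: measurableI => //; exact: measurable_open_box.
suff Hn n : nu (H `&` cube N n%:R) = 0%E.
  apply/eqP; rewrite eq_le measure_ge0 andbT {1}HE.
  apply: (le_trans (measure_sigma_subadditive _ _ _ (@subset_refl _ _))) => //.
    exact: bigcupT_measurable.
  by rewrite eseries0.
set B := H `&` _; have mB : measurable B := mHc n.
(* The shifts 1 / (k + 1) are distinct, hence the copies of [B] are disjoint; they are at most 1,
   hence the copies stay in the cube of radius n + 1. *)
pose F (k : nat) := (fun x => taddN x (vaxis i (- k.+1%:R^-1))) @^-1` B.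
have mF k : measurable (F k) by exact: measurable_shift.
have tF : trivIset setT F.
  apply/trivIsetP => j k _ _ jk; rewrite -subset0 => x [[/= + _] [/= + _]].
  rewrite /H /= !tnth_taddN !tnth_vaxis eqxx => <- /addrI /oppr_inj /invr_inj /eqP.
  by rewrite eqr_nat eqSS eq_sym (negbTE jk).
have sF : \bigcup_k F k `<=` cube N n.+1%:R.
  move=> x [k _ [_ /cubeE xn]]; apply/cubeE => j; have := xn j.
  rewrite tnth_taddN tnth_vaxis -[n.+1%:R]natr1; case: ifP => _; last first.
    by rewrite addr0 => h; rewrite (lt_trans h) // ltrDl ltr01.
  move=> xk; rewrite -[tnth x j](subrK (k.+1%:R^-1)).
  apply: le_lt_trans (ler_normD _ _) _; apply: ltr_leD => //.
  by rewrite ger0_norm // invf_le1 // ler1n.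
have le_n : (\sum_(k <oo) nu (F k) <= nu (cube N n.+1%:R))%E.
  rewrite -measure_semi_bigcup //; last exact: bigcupT_measurable.
  apply: le_measure => //; rewrite inE; first exact: bigcupT_measurable.
  exact: measurable_open_box.
have Fk k : nu (F k) = nu B by rewrite nuS.
have nB : nu B \is a fin_num.
  rewrite ge0_fin_numE //; apply: le_lt_trans (nuF n%:R).
  apply: le_measure; rewrite ?inE //; [exact: measurable_open_box|exact: subIsetr].
have nC : nu (cube N n.+1%:R) \is a fin_num by rewrite ge0_fin_numE.
apply/eqP; apply: contraT => nB0.
have v0 : 0 < fine (nu B) by rewrite fine_gt0 // lt0e nB0 measure_ge0 -ge0_fin_numE.
(* If [B] had positive mass, [m] copies of it would outweigh the cube that contains them. *)
pose m := (Num.truncn (fine (nu (cube N n.+1%:R)) / fine (nu B))).+1.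
have : (\sum_(0 <= k < m) nu (F k) <= nu (cube N n.+1%:R))%E.
  by apply: le_trans le_n; exact: nneseries_lim_ge.
under eq_bigr do rewrite Fk -(fineK nB).
rewrite -(fineK nC) sumEFin lee_fin big_const_nat iter_addr_0 subn0.
rewrite leNgt -[fine (nu B) *+ m]mulr_natl -ltr_pdivrMr //.
by rewrite truncnS_gt.
Qed.

(* Countably many translates of the cube cover the space. *)
Lemma half_open_cube_gt0 (s : R) : 0 < s -> (0 < nu (half_open_cube N s))%E.
Proof.
move=> s0; set Q := half_open_cube N s.
have mQ : measurable Q by exact: measurable_half_open_cube.
rewrite lt0e measure_ge0 andbT; apply/eqP => Q0.
move/eqP: nu0; apply; apply/eqP; rewrite eq_le measure_ge0 andbT.
(* The integer vectors are enumerated by their codes; a number that codes no vector contributes the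
   empty set. *)
pose F n := if unpickle n is Some k then
  (fun x => taddN x [tuple - (s * (tnth (k : N.-tuple int) i)%:~R) | i < N]) @^-1` Q
  else set0.
have mF n : measurable (F n).
  by rewrite /F; case: (unpickle n) => // k; exact: measurable_shift.
have cov : [set: T] `<=` \bigcup_n F n.
  move=> x _; pose k : N.-tuple int := [tuple Num.floor (tnth x i / s) | i < N].
  exists (pickle k) => //; rewrite /F pickleK => i.
  rewrite tnth_taddN !tnth_mktuple.
  have := floor_le_tmp (tnth x i / s); have := lt_succ_floor (tnth x i / s).
  rewrite intrD ler_pdivlMr // ltr_pdivrMr // => ? ?.
  by apply/andP; split; lra.
apply: le_trans (measure_sigma_subadditive _ mF measurableT cov) _.
rewrite eseries0 // => n _ _; rewrite /F; case: (unpickle n) => // k.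
by rewrite nuS.
Qed.

Lemma ge0_integral_shift t D (g : T -> \bar R) : measurable D ->
  measurable_fun D g -> (forall x, D x -> 0 <= g x)%E ->
  (\int[nu]_(x in (fun x => taddN x t) @^-1` D) g (taddN x t) =
   \int[nu]_(x in D) g x)%E.
Proof.
move=> mD mg g0.
rewrite -(@ge0_integral_pushforward _ _ _ _ _ _ (measurable_taddN t) nu D g) //;
  last by move=> x /[!inE]; exact: g0.
have [nu' nu'E] := image_measure_exists nu (measurable_taddN t).
rewrite -nu'E; apply: eq_measure_integral => A mA _.
by rewrite nu'E /pushforward nuS.
Qed.

End Haarlike.

(** * Squared moduli and complex exponentials *)

Section ComplexAlgebra.
Variable R : realType.
Implicit Types (z w : R[i]) (t : R).

Lemma cnorm2_ge0 z : 0 <= cnorm2 z.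
Proof. by rewrite addr_ge0 // sqr_ge0. Qed.

Lemma cnorm20 : cnorm2 (0 : R[i]) = 0.
Proof. by rewrite /cnorm2 /= expr0n addr0. Qed.

Lemma cnorm2M z w : cnorm2 (z * w) = cnorm2 z * cnorm2 w.
Proof. by case: z => a b; case: w => c d; rewrite /cnorm2 /=; ring. Qed.

Lemma cnorm2_eq0 z : (cnorm2 z == 0) = (z == 0).
Proof.
case: z => a b; rewrite /cnorm2 /= paddr_eq0 ?sqr_ge0 // !sqrf_eq0.
by rewrite eq_complex /=.
Qed.

Lemma cnorm2N z : cnorm2 (- z) = cnorm2 z.
Proof. by case: z => a b; rewrite /cnorm2 /=; ring. Qed.

Lemma cnorm2B z w : cnorm2 (z - w) = cnorm2 (w - z).
Proof. by rewrite -cnorm2N opprB. Qed.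

(** Takes the place of the triangle inequality; each use costs a factor 2. *)
Lemma cnorm2D_le z w : cnorm2 (z + w) <= 2 * cnorm2 z + 2 * cnorm2 w.
Proof.
case: z => a b; case: w => c d; rewrite /cnorm2 /=.
have := sqr_ge0 (a - c); have := sqr_ge0 (b - d); nra.
Qed.

Lemma cnorm2B_le z w : cnorm2 z <= 2 * cnorm2 w + 2 * cnorm2 (z - w).
Proof. by have := cnorm2D_le w (z - w); rewrite addrC subrK. Qed.

Lemma cnorm2_conj z : (cnorm2 z)%:C%C = z * conjc z.
Proof. by case: z => a b; rewrite /cnorm2 /=; apply/eqP; rewrite eq_complex /=; apply/andP; split; apply/eqP; ring. Qed.

Lemma cnorm2_real t : cnorm2 t%:C%C = t ^+ 2.
Proof. by rewrite /cnorm2 /= expr0n addr0. Qed.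

Lemma sqr_sum_le (I : Type) (r : seq I) (x : I -> R) :
  (\sum_(i <- r) x i) ^+ 2 <= (size r)%:R * \sum_(i <- r) x i ^+ 2.
Proof.
elim: r => [|i r IH]; first by rewrite !big_nil expr0n mulr0.
rewrite !big_cons /=; set X := \sum_(j <- r) x j in IH *.
set Y := \sum_(j <- r) _ in IH *.
(* This sums 2 a b <= a^2 + b^2 over the pairs [x i], [x j], by an induction of its own. *)
have H : 2 * x i * X <= (size r)%:R * x i ^+ 2 + Y.
  rewrite /X /Y; elim: {IH X Y} r => [|j r IH]; first by rewrite !big_nil mulr0 mul0r addr0.
  rewrite !big_cons /= -natr1; have := sqr_ge0 (x i - x j); nra.
rewrite -natr1; nra.
Qed.

Lemma cnorm2_sum_le (I : Type) (r : seq I) (z : I -> R[i]) :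
  cnorm2 (\sum_(i <- r) z i) <= (size r)%:R * \sum_(i <- r) cnorm2 (z i).
Proof.
rewrite /cnorm2 (raddf_sum (@complex.Re R)) (raddf_sum (@complex.Im R)).
by rewrite big_split mulrDr lerD // sqr_sum_le.
Qed.

Lemma cnorm2_sum_ord_le (n : nat) (z : 'I_n -> R[i]) :
  cnorm2 (\sum_i z i) <= n%:R * \sum_i cnorm2 (z i).
Proof.
by apply: le_trans (cnorm2_sum_le _ _) _; rewrite /index_enum -enumT size_enum_ord.
Qed.

Lemma expiD s t : expi (s + t) = expi s * expi t :> R[i].
Proof.
rewrite /expi cosD sinD; apply/eqP; rewrite eq_complex /=.
by rewrite eqxx /= addrC.
Qed.

Lemma expi0 : expi 0 = 1 :> R[i].
Proof. by rewrite /expi cos0 sin0. Qed.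

Lemma expiN t : expi (- t) = conjc (expi t).
Proof. by rewrite /expi cosN sinN. Qed.

Lemma cnorm2_expi t : cnorm2 (expi t) = 1.
Proof. by rewrite /cnorm2 /= cos2Dsin2. Qed.

Lemma expi_2pi_int (k : int) : expi (2 * pi * k%:~R) = 1 :> R[i].
Proof.
have e1 : expi (2 * pi) = 1 :> R[i].
  by rewrite /expi mulrC mulr_natr cos2pi sin2pi.
have nat1 n : expi (2 * pi * n%:R) = 1 :> R[i].
  elim: n => [|n IH]; first by rewrite mulr0 expi0.
  by rewrite -[n.+1%:R]natr1 mulrDr expiD IH mulr1 e1 mulr1.
case: k => n; first exact: nat1.
by rewrite NegzE mulrNz mulrN expiN nat1 conjc1.
Qed.

Lemma expi_pi : expi pi = -1 :> R[i].
Proof. by rewrite /expi cospi sinpi; apply/eqP; rewrite eq_complex /= oppr0 !eqxx. Qed.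

End ComplexAlgebra.

(** * Integration of bounded complex functions *)

Section BoundedMeasurable.
Context d (T : measurableType d) (R : realType).
Implicit Types (f g : T -> R) (F G : T -> R[i]).

(** On a set of finite measure these functions are integrable, and they are closed under products as
    well as sums; this settles the integrability conditions for all trigonometric sums. *)
Definition bounded_measurable f :=
  measurable_fun setT f /\ exists K : R, forall x, `|f x| <= K.

Definition cbounded_measurable F :=
  bounded_measurable (fun x => complex.Re (F x)) /\
  bounded_measurable (fun x => complex.Im (F x)).

Local Notation bm := bounded_measurable.
Local Notation cbm := cbounded_measurable.

Lemma bm_cst c : bm (fun=> c).
Proof. by split; [exact: measurable_cst|exists `|c|]. Qed.

Lemma bmD f g : bm f -> bm g -> bm (fun x => f x + g x).
Proof.
move=> [mf [K fK]] [mg [L gL]]; split; first exact: measurable_funD.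
by exists (K + L) => x; apply: le_trans (ler_normD _ _) _; exact: lerD.
Qed.

Lemma bmM f g : bm f -> bm g -> bm (fun x => f x * g x).
Proof.
move=> [mf [K fK]] [mg [L gL]]; split; first exact: measurable_funM.
by exists (K * L) => x; rewrite normrM ler_pM.
Qed.

Lemma bmN f : bm f -> bm (fun x => - f x).
Proof.
move=> [mf [K fK]]; split; first exact: measurable_funN.
by exists K => x; rewrite normrN.
Qed.

Lemma bm_cos f : measurable_fun setT f -> bm (fun x => cos (f x)).
Proof.
move=> mf; split; last by exists 1 => x; exact: cos_max.
by apply: measurableT_comp => //; apply: continuous_measurable_fun; exact: continuous_cos.
Qed.

Lemma bm_sin f : measurable_fun setT f -> bm (fun x => sin (f x)).
Proof.
move=> mf; split; last by exists 1 => x; exact: sin_max.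
by apply: measurableT_comp => //; apply: continuous_measurable_fun; exact: continuous_sin.
Qed.

Lemma cbm_cst c : cbm (fun=> c).
Proof. by split; exact: bm_cst. Qed.

Lemma cbmD F G : cbm F -> cbm G -> cbm (fun x => F x + G x).
Proof.
move=> [F1 F2] [G1 G2]; split.
  rewrite (_ : (fun x => _) = fun x => complex.Re (F x) + complex.Re (G x)); first exact: bmD.
  by apply/funext => x /=; rewrite raddfD.
rewrite (_ : (fun x => _) = fun x => complex.Im (F x) + complex.Im (G x)); first exact: bmD.
by apply/funext => x /=; rewrite raddfD.
Qed.

Lemma cbmM F G : cbm F -> cbm G -> cbm (fun x => F x * G x).
Proof.
move=> [F1 F2] [G1 G2]; split.
  rewrite (_ : (fun x => _) = fun x => complex.Re (F x) * complex.Re (G x) +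
      - (complex.Im (F x) * complex.Im (G x))).
    by apply: bmD; [exact: bmM|apply: bmN; exact: bmM].
  by apply/funext => x /=; case: (F x); case: (G x).
rewrite (_ : (fun x => _) = fun x => complex.Re (F x) * complex.Im (G x) +
    complex.Im (F x) * complex.Re (G x)).
  by apply: bmD; exact: bmM.
by apply/funext => x /=; case: (F x); case: (G x).
Qed.

Lemma cbm_expi f : measurable_fun setT f -> cbm (fun x => expi (f x)).
Proof. by move=> mf; split; [exact: bm_cos|exact: bm_sin]. Qed.

Lemma cbm_sum (I : Type) (r : seq I) (F : I -> T -> R[i]) :
  (forall i, cbm (F i)) -> cbm (fun x => \sum_(i <- r) F i x).
Proof.
move=> mF; elim: r => [|i r IH].
  by under eq_fun do rewrite big_nil; exact: cbm_cst.
by under eq_fun do rewrite big_cons; exact: cbmD.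
Qed.

Lemma bm_cnorm2 F : cbm F -> bm (fun x => cnorm2 (F x)).
Proof.
by move=> [F1 F2]; apply: bmD; [exact: (bmM F1 F1)|exact: (bmM F2 F2)].
Qed.

Variables (nu : {measure set T -> \bar R}) (D : set T).
Hypotheses (mD : measurable D) (nuD : (nu D < +oo)%E).

Lemma bm_integrable f : bm f -> nu.-integrable D (EFin \o f).
Proof.
move=> [mf [K fK]]; apply: measurable_bounded_integrable => //.
  exact: measurable_funTS.
exists K; split; first exact: num_real.
move=> x Kx y _ /=; exact: le_trans (fK y) (ltW Kx).
Qed.

Lemma EFin_Rintegral f : bm f ->
  (\int[nu]_(x in D) (f x)%:E = (\int[nu]_(x in D) f x)%:E)%E.
Proof.
by move=> bf; rewrite fineK //; apply: integrable_fin_num => //; exact: bm_integrable.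
Qed.

Definition cintegral F : R[i] :=
  (\int[nu]_(x in D) complex.Re (F x) +i* \int[nu]_(x in D) complex.Im (F x))%C.

Lemma cintegralD F G : cbm F -> cbm G ->
  cintegral (fun x => F x + G x) = cintegral F + cintegral G.
Proof.
move=> [F1 F2] [G1 G2]; apply/eqP; rewrite eq_complex /=; apply/andP; split; apply/eqP.
  rewrite -RintegralD //; try exact: bm_integrable.
  by apply: eq_Rintegral => x _; rewrite raddfD.
rewrite -RintegralD //; try exact: bm_integrable.
by apply: eq_Rintegral => x _; rewrite raddfD.
Qed.

Lemma cintegralZ c F : cbm F -> cintegral (fun x => c * F x) = c * cintegral F.
Proof.
move=> [F1 F2]; case: c => a b.
have iR c : nu.-integrable D (EFin \o (fun x => c * complex.Re (F x))).
  by apply: bm_integrable; apply: bmM => //; exact: bm_cst.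
have iI c : nu.-integrable D (EFin \o (fun x => c * complex.Im (F x))).
  by apply: bm_integrable; apply: bmM => //; exact: bm_cst.
apply/eqP; rewrite eq_complex /=; apply/andP; split; apply/eqP.
  rewrite -!RintegralZl //; try exact: bm_integrable.
  rewrite -RintegralB //.
  by apply: eq_Rintegral => x _; case: (F x).
rewrite -!RintegralZl //; try exact: bm_integrable.
rewrite -RintegralD //.
by apply: eq_Rintegral => x _; case: (F x).
Qed.

Lemma cintegral_sum (I : Type) (r : seq I) (F : I -> T -> R[i]) :
  (forall i, cbm (F i)) ->
  cintegral (fun x => \sum_(i <- r) F i x) = \sum_(i <- r) cintegral (F i).
Proof.
move=> mF; elim: r => [|i r IH].
  rewrite big_nil; under eq_fun do rewrite big_nil.
  by rewrite /cintegral /= !Rintegral_cst // mul0r.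
rewrite big_cons -IH; under eq_fun do rewrite big_cons.
by rewrite cintegralD //; exact: cbm_sum.
Qed.

Lemma cintegral_cnorm2 F : cbm F ->
  (\int[nu]_(x in D) cnorm2 (F x))%:C%C = cintegral (fun x => F x * conjc (F x)).
Proof.
move=> bF; apply/eqP; rewrite eq_complex /=; apply/andP; split; apply/eqP.
  by apply: eq_Rintegral => x _; rewrite -cnorm2_conj.
transitivity (\int[nu]_(x in D) (0 : R)); first by rewrite Rintegral_cst // mul0r.
by apply: eq_Rintegral => x _; rewrite -cnorm2_conj.
Qed.

End BoundedMeasurable.
Notation bm := bounded_measurable.
Notation cbm := cbounded_measurable.

(** * The inner product and integer vectors *)

Section DotProduct.
Variables (R : realType) (N : nat).
Local Notation T := (N.-tuple R).
Implicit Types (x y z : T).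

Definition intv (k : N.-tuple int) : T := [tuple (tnth k i)%:~R | i < N].

Lemma dotND x y z : dotN x (taddN y z) = dotN x y + dotN x z.
Proof.
by rewrite /dotN -big_split; apply: eq_bigr => i _ /=; rewrite tnth_taddN mulrDr.
Qed.

Lemma dotNDl x y z : dotN (taddN x y) z = dotN x z + dotN y z.
Proof.
by rewrite /dotN -big_split; apply: eq_bigr => i _ /=; rewrite tnth_taddN mulrDl.
Qed.

Lemma dotN_vaxis x i s : dotN x (vaxis i s) = tnth x i * s.
Proof.
rewrite /dotN (bigD1 i) //= big1 => [|j ji]; first by rewrite tnth_vaxis eqxx addr0.
by rewrite tnth_vaxis (negbTE ji) mulr0.
Qed.

Lemma taddNA x y z : taddN x (taddN y z) = taddN (taddN x y) z.
Proof. by apply: eq_tnthP => i; rewrite !tnth_taddN addrA. Qed.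

Lemma vaxisD i s t : taddN (vaxis i s) (vaxis i t) = vaxis i (s + t) :> T.
Proof.
by apply: eq_tnthP => j; rewrite tnth_taddN !tnth_vaxis; case: ifP; rewrite ?addr0.
Qed.

Lemma measurable_dotN x D : measurable_fun D (dotN x).
Proof.
by apply: measurable_sum => j; apply: measurable_funM => //; exact: measurable_tnth_fun.
Qed.

Lemma tsubNK x y : taddN y (tsubN x y) = x.
Proof. by apply: eq_tnthP => i; rewrite tnth_taddN tnth_tsubN addrC subrK. Qed.

Lemma taddNK x y : tsubN (taddN y x) y = x.
Proof. by apply: eq_tnthP => i; rewrite tnth_tsubN tnth_taddN addrC addKr. Qed.

Lemma taddNC x y : taddN x y = taddN y x.
Proof. by apply: eq_tnthP => i; rewrite !tnth_taddN addrC. Qed.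

End DotProduct.
Arguments intv {R N} k.

(** * Orthogonality of characters on the period cube *)

Section Fourier.
Variables (R : realType) (N : nat).
Local Notation T := (N.-tuple R).
Variable nu : {measure set T -> \bar R}.
Hypothesis nuH : haarlike nu.
Local Notation Q := (half_open_cube N (2 * pi : R)).
Let mQ : measurable Q := measurable_half_open_cube _.

Let pi0 : 0 < pi :> R. Proof. exact: pi_gt0. Qed.

Lemma period_cube_lty : (nu Q < +oo)%E.
Proof.
have [_ nuF _] := nuH.
apply: le_lt_trans (nuF (2 * pi)); apply: le_measure; rewrite ?inE //.
  exact: measurable_open_box.
by move=> x xQ; apply/cubeE => i; have /andP[x0 ?] := xQ i; rewrite ger0_norm.
Qed.

Lemma period_cube_gt0 : 0 < fine (nu Q).
Proof.
by rewrite fine_gt0 // period_cube_lty half_open_cube_gt0 // mulr_gt0 // pi_gt0.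
Qed.

(** The two cubes differ by the faces x_i = 0, which lie in null hyperplanes. *)
Lemma ge0_integral_Omega0 (g : T -> \bar R) :
  measurable_fun Q g -> (forall x, Q x -> 0 <= g x)%E ->
  (\int[nu]_(x in @Omega0 R N) g x = \int[nu]_(x in Q) g x)%E.
Proof.
move=> mg g0; pose H := \bigcup_(i in [set: 'I_N]) [set x : T | tnth x i = 0].
have mH : measurable H.
  by apply: fin_bigcup_measurable => // i _; exact: measurable_hyperplane.
have H0 : nu H = 0%E.
  apply: measure_negligible => //.
  apply: (@negligibleS _ _ _ _ (\bigcup_n
      (if insub n is Some i then [set x : T | tnth x (i : 'I_N) = 0] else set0))).
    by move=> x [i _ xi]; exists (i : nat) => //; rewrite valK.
  apply: negligible_bigcup => n; case: insub => [i|]; last exact: negligible_set0.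
  by apply/negligibleP; [exact: measurable_hyperplane|exact: hyperplane_null].
rewrite [RHS](ge0_negligible_integral mH) //; congr integral.
apply/seteqP; split=> x.
  move=> xO; split=> [i|[i _ xi]]; first by have /andP[/ltW -> ->] := xO i.
  by have := xO i; rewrite xi ltxx.
move=> [xQ xH] i; have /andP[xi ->] := xQ i; rewrite andbT lt_def xi andbT.
by apply/eqP => xi0; apply: xH; exists i.
Qed.

Section Periodic.
Variable i : 'I_N.
Implicit Type g : T -> \bar R.

Let measurable_half (b : bool) (c : R) :
  measurable (Q `&` [set x | if b then tnth x i < c else c <= tnth x i]).
Proof.
apply: measurableI => //; rewrite -[X in measurable X]setTI.
have -> : [set: T] `&` [set x | if b then tnth x i < c else c <= tnth x i] =
    [set: T] `&` (fun x => tnth x i) @^-1`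
      (if b then `]-oo, c[%classic else `[c, +oo[%classic).
  by congr (_ `&` _); apply/seteqP; split=> x /=; case: b; rewrite /= in_itv /= ?andbT.
by apply: measurable_tnth_fun => //; case: b; exact: measurable_itv.
Qed.

Let QE (c : R) : Q = (Q `&` [set x | tnth x i < c]) `|` (Q `&` [set x | c <= tnth x i]).
Proof.
rewrite -setIUr; apply/seteqP; split=> [x xQ|x [] //]; split=> //=.
by apply/orP; rewrite orbC leNgt orNb.
Qed.

Let disj (c : R) : [disjoint (Q `&` [set x | tnth x i < c]) & (Q `&` [set x | c <= tnth x i])].
Proof.
apply/disj_setPS => x [[_ /= h1] [_ /= h2]].
by move: h2; rewrite leNgt h1.
Qed.

(* Cut the period cube along the i-th axis: the part pushed outside by the shift
   comes back by periodicity. *)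
Lemma ge0_integral_periodic_shift g s : 0 <= s <= 2 * pi ->
  measurable_fun setT g -> (forall x, 0 <= g x)%E ->
  (forall x, g (taddN x (vaxis i (2 * pi))) = g x) ->
  (\int[nu]_(x in Q) g (taddN x (vaxis i s)) = \int[nu]_(x in Q) g x)%E.
Proof.
move=> /andP[s0 s2pi] mg g0 gper.
have mgs : measurable_fun setT (fun x => g (taddN x (vaxis i s))).
  by apply: measurableT_comp => //; exact: measurable_taddN.
rewrite [in LHS](QE (2 * pi - s)) [in RHS](QE s).
rewrite !ge0_integral_setU //; try exact: (measurable_half true);
  try exact: (measurable_half false); try exact: measurable_funTS.
rewrite addeC; congr (_ + _)%E.
  transitivity (\int[nu]_(x in Q `&` [set x | (2 * pi - s <= tnth x i)%R])
      g (taddN x (vaxis i (s - 2 * pi)%R)))%E.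
    apply: eq_integral => x _; rewrite -(gper (taddN x (vaxis i (s - _)))).
    by rewrite -taddNA vaxisD subrK.
  rewrite -(ge0_integral_shift nuH (vaxis i (s - 2 * pi))
    (D := Q `&` [set x | tnth x i < s]) (g := g)) //.
  - congr integral; apply/seteqP; split=> x.
      move=> [xQ /= xi]; split; last first.
        by have /andP[_ ?] := xQ i; rewrite /= tnth_taddN tnth_vaxis eqxx; lra.
      move=> j; rewrite tnth_taddN tnth_vaxis; have /andP[x0 x1] := xQ j.
      by case: eqP => [e|_]; [subst j; apply/andP; split; lra|rewrite addr0 x0].
    move=> [xQ]; rewrite /= tnth_taddN tnth_vaxis eqxx => xi; split; last first.
      by have /andP[x0 _] := xQ i; move: x0; rewrite /= tnth_taddN tnth_vaxis eqxx; lra.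
    move=> j; have := xQ j; rewrite tnth_taddN tnth_vaxis => /andP[].
    by case: eqP => [e|_]; [subst j => ? ?; apply/andP; split; lra|rewrite addr0 => -> ->].
  - exact: (measurable_half true).
  - exact: measurable_funTS.
rewrite -(ge0_integral_shift nuH (vaxis i s)
  (D := Q `&` [set x | s <= tnth x i]) (g := g)) //.
- congr integral; apply/seteqP; split=> x.
    move=> [xQ /= xi]; split; last first.
      by have /andP[? _] := xQ i; rewrite /= tnth_taddN tnth_vaxis eqxx; lra.
    move=> j; rewrite tnth_taddN tnth_vaxis; have /andP[x0 x1] := xQ j.
    by case: eqP => [e|_]; [subst j; apply/andP; split; lra|rewrite addr0 x0].
  move=> [xQ]; rewrite /= tnth_taddN tnth_vaxis eqxx => xi; split; last first.
    by have /andP[_ x0] := xQ i; move: x0; rewrite /= tnth_taddN tnth_vaxis eqxx; lra.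
  move=> j; have := xQ j; rewrite tnth_taddN tnth_vaxis => /andP[].
  by case: eqP => [e|_]; [subst j => ? ?; apply/andP; split; lra|rewrite addr0 => -> ->].
- exact: (measurable_half false).
- exact: measurable_funTS.
Qed.

(** The shift identity is available for nonnegative functions, so it is applied to K + h with K a
    bound of |h|. It says that K - h and K + h have the same integral. *)
Lemma Rintegral_antiperiodic (h : T -> R) s : bm h -> 0 <= s <= 2 * pi ->
  (forall x, h (taddN x (vaxis i (2 * pi))) = h x) ->
  (forall x, h (taddN x (vaxis i s)) = - h x) ->
  \int[nu]_(x in Q) h x = 0.
Proof.
move=> bh s02 hper hanti; have [mh [K hK]] := bh.
have bK : bm (fun _ : T => (K : R)) by exact: bm_cst.
have Qf := period_cube_lty.
have := @ge0_integral_periodic_shift (fun x => (K + h x)%:E) s s02.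
rewrite (eq_integral (fun x => (K + - h x)%:E)) => [|x _]; last by rewrite hanti.
rewrite !(EFin_Rintegral mQ Qf) //; [|exact: bmD|by apply: bmD => //; exact: bmN].
rewrite !RintegralD //; try exact: bm_integrable;
  last by apply: bm_integrable => //; exact: bmN.
have -> : \int[nu]_(x in Q) (- h x) = - \int[nu]_(x in Q) h x.
  rewrite -mulN1r -RintegralZl //; last exact: bm_integrable.
  by apply: eq_Rintegral => x _; rewrite mulN1r.
move=> H; have : (\int[nu]_(x in Q) K + - \int[nu]_(x in Q) h x)%:E =
    (\int[nu]_(x in Q) K + \int[nu]_(x in Q) h x)%:E.
  apply: H => [|x|x]; last by rewrite hper.
    by apply/measurable_EFinP; apply: measurable_funD.
  by rewrite lee_fin -lerBlDl sub0r; have := hK x; rewrite ler_norml => /andP[].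
by move=> [] /addrI /eqP; rewrite eq_sym -addr_eq0 -mulr2n mulrn_eq0 /= => /eqP.
Qed.

End Periodic.

Lemma cbm_exp_dotN (u : T) : cbm (fun x => expi (dotN u x)).
Proof. by apply: cbm_expi; exact: measurable_dotN. Qed.

Lemma cintegral_exp (k : N.-tuple int) :
  cintegral nu Q (fun x => expi (dotN (intv k) x)) =
  if k == [tuple 0 | i < N] then (fine (nu Q))%:C%C else 0.
Proof.
have Qf := period_cube_lty.
case: eqP => [->|/eqP k0].
  have e1 (x : T) : expi (dotN (intv [tuple 0 | i < N]) x) = 1.
    rewrite /dotN big1 ?expi0 // => i _.
    by rewrite !tnth_mktuple mul0r.
  under eq_fun do rewrite e1.
  by rewrite /cintegral /= !Rintegral_cst // mul1r mul0r.
have [i ki] : exists i, tnth k i != 0.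
  apply/existsP; rewrite -negb_forall; apply: contra k0 => /forallP k0.
  by apply/eqP/eq_from_tnth => i; rewrite tnth_mktuple; apply/eqP.
pose K : R := `|(tnth k i)%:~R|.
(* A nonzero integer has modulus at least 1, so the shift pi / K stays within one period. *)
have K1 : 1 <= K.
  by rewrite /K -intr_norm -[1]/(1%:~R) ler_int -gtz0_ge1 normr_gt0.
have K0 : 0 < K by exact: lt_le_trans K1.
have sP : 0 <= pi / K <= 2 * pi.
  apply/andP; split; first by apply: divr_ge0; exact: ltW.
  by rewrite ler_pdivrMr //; have := pi0; nra.
have per (x : T) : expi (dotN (intv k) (taddN x (vaxis i (2 * pi)))) =
    expi (dotN (intv k) x).
  by rewrite dotND dotN_vaxis tnth_mktuple expiD [_%:~R * _]mulrC expi_2pi_int mulr1.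
have anti (x : T) : expi (dotN (intv k) (taddN x (vaxis i (pi / K)))) =
    - expi (dotN (intv k) x).
  rewrite dotND dotN_vaxis tnth_mktuple expiD -mulrN1; congr (_ * _).
  rewrite mulrCA /K; case: (ltrgt0P ((tnth k i)%:~R : R)) => [h|h|h].
  - by rewrite divff ?mulr1 ?expi_pi // gt_eqF.
  - by rewrite invrN mulrN divff ?lt_eqF // mulrN1 expiN expi_pi rmorphN1.
  - by move: K0; rewrite /K h normr0 ltxx.
have [b1 b2] := cbm_exp_dotN (intv k).
apply/eqP; rewrite eq_complex /=; apply/andP; split; apply/eqP.
  apply: (Rintegral_antiperiodic (i := i) _ sP) => // x.
    by have /(congr1 (@complex.Re R)) := per x.
  by have /(congr1 (@complex.Re R)) := anti x; rewrite raddfN.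
apply: (Rintegral_antiperiodic (i := i) _ sP) => // x.
  by have /(congr1 (@complex.Im R)) := per x.
by have /(congr1 (@complex.Im R)) := anti x; rewrite raddfN.
Qed.

Lemma parseval (r : seq (N.-tuple int)) (b : N.-tuple int -> R[i]) : uniq r ->
  \int[nu]_(x in Q) cnorm2 (\sum_(m <- r) b m * expi (dotN (intv m) x)) =
  fine (nu Q) * \sum_(m <- r) cnorm2 (b m).
Proof.
move=> ur; have Qf := period_cube_lty.
have bE m : cbm (fun x => b m * expi (dotN (intv m) x)).
  by apply: cbmM; [exact: cbm_cst|exact: cbm_exp_dotN].
(* The identity is moved to [R[i]], where the squared modulus expands as a product with the
   conjugate. *)
suff : (\int[nu]_(x in Q) cnorm2 (\sum_(m <- r) b m * expi (dotN (intv m) x)))%:C%C =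
    (fine (nu Q) * \sum_(m <- r) cnorm2 (b m))%:C%C by case.
rewrite cintegral_cnorm2 //; last exact: cbm_sum.
pose d m m' : N.-tuple int := [tuple tnth m i - tnth m' i | i < N].
transitivity (cintegral nu Q (fun x => \sum_(m <- r) \sum_(m' <- r)
    b m * conjc (b m') * expi (dotN (intv (d m m')) x))).
  congr cintegral; apply/funext => x; rewrite mulr_suml; apply: eq_bigr => m _.
  rewrite rmorph_sum mulr_sumr; apply: eq_bigr => m' _ /=.
  have -> : dotN (intv (d m m')) x = dotN (intv m) x - dotN (intv m') x.
    rewrite /dotN -sumrB; apply: eq_bigr => i _.
    by rewrite !tnth_mktuple intrB mulrBl.
  by rewrite expiD expiN rmorphM /= mulrACA.
have bE2 m m' : cbm (fun x => b m * conjc (b m') * expi (dotN (intv (d m m')) x)).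
  by apply: cbmM; [exact: cbm_cst|exact: cbm_exp_dotN].
rewrite cintegral_sum //; last by move=> m; exact: cbm_sum.
rewrite mulr_sumr rmorph_sum /= big_seq [RHS]big_seq; apply: eq_bigr => m mr.
rewrite cintegral_sum // (bigD1_seq m) //= big1 ?addr0 => [|m' m'm].
  rewrite cintegralZ //; last exact: cbm_exp_dotN.
  rewrite cintegral_exp ifT; last first.
    by apply/eqP/eq_from_tnth => i; rewrite !tnth_mktuple subrr.
  by rewrite -cnorm2_conj -rmorphM mulrC.
rewrite cintegralZ //; last exact: cbm_exp_dotN.
rewrite cintegral_exp ifN ?mulr0 //; apply: contra m'm => /eqP dmm.
apply/eqP/eq_from_tnth => i; apply/eqP; rewrite eq_sym -subr_eq0.
by have := congr1 (fun t => tnth t i) dmm; rewrite !tnth_mktuple => ->.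
Qed.

End Fourier.

(** The indices make [A] act on row vectors. Applied to E and to its inverse, this yields the two
    sides of the comparison; the 1 in the constant keeps it positive. *)
Lemma linear_cnorm2_bound (R : realType) (M : nat) (A : 'M[R[i]]_M) :
  exists2 C, 0 < C & forall x : 'I_M -> R[i],
    \sum_k cnorm2 (\sum_j A j k * x j) <= C * \sum_j cnorm2 (x j).
Proof.
pose a := \sum_k \sum_j cnorm2 (A j k).
have a0 : 0 <= a by apply: sumr_ge0 => k _; apply: sumr_ge0 => j _; exact: cnorm2_ge0.
exists (1 + M%:R * a); first by rewrite ltr_pwDl // mulr_ge0.
move=> x; set X := \sum_j cnorm2 (x j).
have xX j : cnorm2 (x j) <= X.
  rewrite /X (bigD1 j) //= lerDl; apply: sumr_ge0 => ? _; exact: cnorm2_ge0.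
have X0 : 0 <= X by apply: sumr_ge0 => j _; exact: cnorm2_ge0.
apply: (@le_trans _ _ (M%:R * a * X)); last by rewrite ler_wpM2r // lerDr.
rewrite -mulrA mulr_suml mulr_sumr; apply: ler_sum => k _.
apply: le_trans (cnorm2_sum_ord_le _) _; rewrite ler_wpM2l // mulr_suml.
by apply: ler_sum => j _; rewrite cnorm2M ler_wpM2l // cnorm2_ge0.
Qed.

(** * Two-sided bounds for finite sums on the union of shifted cubes *)

Section FiniteSums.
Variables (R : realType) (N M : nat).
Local Notation T := (N.-tuple R).
Variables (u v : 'I_M -> T) (nu : {measure set T -> \bar R}).
Hypothesis nuH : haarlike nu.
Hypothesis v2pi : forall (k : 'I_M) (i : 'I_N), exists z : int,
  tnth (v k) i = 2 * pi * z%:~R.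
Let E := \matrix_(j < M, k < M) expi (dotN (u j) (v k)).
Hypothesis Eunit : E \in unitmx.
Local Notation Q := (half_open_cube N (2 * pi : R)).
Local Notation I := ('I_M * N.-tuple int)%type.

Definition shifted_cubes : set T := [set y | exists k, Omega0 (tsubN y (v k))].

(** If two of the vectors coincided, E would have two equal columns, against (A2). This is what
    makes the shifted cubes disjoint. *)
Lemma v_inj : injective v.
Proof.
move=> k l vkl; apply/eqP; apply: contraLR Eunit => kl.
rewrite -unitmx_tr unitmxE (determinant_alternate kl) ?unitr0 // => j.
by rewrite !mxE vkl.
Qed.

Lemma expi_dotN_int_v (m : N.-tuple int) k : expi (dotN (intv m) (v k)) = 1.
Proof.
have [z zP] := choice (v2pi k).
have -> : dotN (intv m) (v k) = 2 * pi * (\sum_(i < N) tnth m i * z i)%:~R.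
  rewrite rmorph_sum mulr_sumr /dotN; apply: eq_bigr => i _ /=.
  by rewrite tnth_mktuple zP intrM mulrCA.
exact: expi_2pi_int.
Qed.

Let Om k : set T := [set y | Omega0 (tsubN y (v k))].

Lemma Omega0E : @Omega0 R N = open_box [tuple 0 | i < N] [tuple 2 * pi | i < N].
Proof. by apply/seteqP; split=> x h i; have := h i; rewrite !tnth_mktuple. Qed.

Lemma measurable_Omega0 : measurable (@Omega0 R N).
Proof. by rewrite Omega0E; exact: measurable_open_box. Qed.

Let OmE k : Om k = (fun x => taddN x [tuple - tnth (v k) i | i < N]) @^-1` (@Omega0 R N).
Proof.
apply/seteqP; split=> x xk i; have := xk i;
  by rewrite tnth_tsubN tnth_taddN tnth_mktuple.
Qed.

Let measurable_Om k : measurable (Om k).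
Proof. by rewrite OmE; apply: measurable_shift; exact: measurable_Omega0. Qed.

Let shifted_cubesE : shifted_cubes = \big[setU/set0]_(k <- enum 'I_M) Om k.
Proof.
rewrite -bigcup_seq; apply/seteqP; split=> x [k].
  by exists k => //=; rewrite mem_enum.
by move=> _ xk; exists k.
Qed.

Lemma measurable_shifted_cubes : measurable shifted_cubes.
Proof. by rewrite shifted_cubesE; exact: bigsetU_measurable. Qed.

Let trivIset_Om : trivIset [set` enum 'I_M] Om.
Proof.
apply/trivIsetP => k l _ _ kl; rewrite -subset0 => x [xk xl].
move/negP: kl; apply; apply/eqP/v_inj/eq_tnthP => i.
have := xk i; have := xl i; rewrite !tnth_tsubN.
have [z ->] := v2pi k i; have [w ->] := v2pi l i => /andP[a1 a2] /andP[b1 b2].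
have p0 : 0 < 2 * pi :> R by rewrite mulr_gt0 // pi_gt0.
suff -> : z = w by [].
(* A common point lies less than 2 pi above both coordinates, so these multiples of 2 pi differ by
   less than 2 pi. *)
have h1 : 2 * pi * (z%:~R - w%:~R) < 2 * pi * 1 :> R by rewrite mulrBr mulr1; lra.
have h2 : 2 * pi * (w%:~R - z%:~R) < 2 * pi * 1 :> R by rewrite mulrBr mulr1; lra.
move: h1 h2; rewrite !ltr_pM2l // -!intrB -[1]/(1%:~R) !ltr_int; lia.
Qed.

Lemma integral_shifted_cubes (g : T -> \bar R) :
  measurable_fun setT g -> (forall x, 0 <= g x)%E ->
  (\int[nu]_(y in shifted_cubes) g y =
   \int[nu]_(x in Q) \sum_(k < M) g (taddN x (v k)))%E.
Proof.
move=> mg g0; rewrite shifted_cubesE ge0_integral_bigsetU //; last 2 first.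
- exact: enum_uniq.
- exact: measurable_funTS.
have mgk k : measurable_fun setT (fun x => g (taddN x (v k))).
  by apply: measurableT_comp => //; exact: measurable_taddN.
rewrite big_enum /= ge0_integral_sum //; last 2 first.
- exact: measurable_half_open_cube.
- by move=> k; exact: measurable_funTS.
apply: eq_bigr => k _.
rewrite -(ge0_integral_Omega0 nuH) //; last exact: measurable_funTS.
rewrite -(ge0_integral_shift nuH (v k) (D := Om k) (g := g)) //; last exact: measurable_funTS.
congr integral; apply/seteqP; split=> x; rewrite /Om /=;
  by rewrite [taddN x _]taddNC taddNK.
Qed.

Definition freq (p : I) : T := taddN (u p.1) (intv p.2).

Definition exp_sum (r : seq I) (b : I -> R[i]) (y : T) : R[i] :=
  \sum_(p <- r) b p * expi (dotN (freq p) y).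

Lemma cbm_exp_sum r b : cbm (exp_sum r b).
Proof.
apply: cbm_sum => p; apply: cbmM; [exact: cbm_cst|exact: cbm_exp_dotN].
Qed.

(** The g_j of the overview: the terms attached to u_j, with the factor e^{i(u_j, y)} taken out. *)
Let component r (b : I -> R[i]) j y : R[i] :=
  \sum_(m <- [seq p.2 | p <- r & p.1 == j]) b (j, m) * expi (dotN (intv m) y).

Lemma exp_sum_shift r b y k : exp_sum r b (taddN y (v k)) =
  \sum_j E j k * (expi (dotN (u j) y) * component r b j y).
Proof.
rewrite /exp_sum (partition_big (fun p : I => p.1) xpredT) //=.
apply: eq_bigr => j _; rewrite /component big_map big_filter !mulr_sumr.
apply: eq_bigr => -[j' m] /= /eqP ->; rewrite mxE dotND !dotNDl !expiD /=.
by rewrite expi_dotN_int_v mulr1; ring.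
Qed.

Lemma integral_component r b : uniq r ->
  (\int[nu]_(x in Q) (\sum_j cnorm2 (component r b j x))%:E =
   (fine (nu Q) * \sum_(p <- r) cnorm2 (b p))%:E)%E.
Proof.
move=> ur; have Qf := period_cube_lty nuH.
have mQ : measurable Q := measurable_half_open_cube _.
have bc j : bm (fun x => cnorm2 (component r b j x)).
  apply: bm_cnorm2; apply: cbm_sum => m.
  by apply: cbmM; [exact: cbm_cst|exact: cbm_exp_dotN].
under eq_integral do rewrite -sumEFin.
rewrite ge0_integral_sum //; last 2 first.
- by move=> j; apply/measurable_EFinP; apply: measurable_funTS; case: (bc j).
- by move=> j x _; rewrite lee_fin cnorm2_ge0.
transitivity (\sum_j (fine (nu Q) *
    \sum_(m <- [seq p.2 | p <- r & p.1 == j]) cnorm2 (b (j, m)))%:E)%E.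
  apply: eq_bigr => j _; rewrite (EFin_Rintegral mQ Qf) // parseval //.
  rewrite map_inj_in_uniq ?filter_uniq // => -[j1 m1] [j2 m2].
  by rewrite !mem_filter /= => /andP[/eqP -> _] /andP[/eqP -> _] ->.
rewrite sumEFin -mulr_sumr [in RHS](partition_big (fun p : I => p.1) xpredT) //=.
congr ((_ * _)%:E); apply: eq_bigr => j _; rewrite big_map big_filter.
by apply: eq_bigr => -[j' m] /= /eqP ->.
Qed.

Lemma exp_sum_bounds : exists c1 c2, [/\ 0 < c1, 0 < c2 &
  forall r b, uniq r ->
    ((c1 * \sum_(p <- r) cnorm2 (b p))%:E <=
      \int[nu]_(y in shifted_cubes) (cnorm2 (exp_sum r b y))%:E)%E /\
    (\int[nu]_(y in shifted_cubes) (cnorm2 (exp_sum r b y))%:E <=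
      (c2 * \sum_(p <- r) cnorm2 (b p))%:E)%E].
Proof.
have [C C0 CP] := linear_cnorm2_bound E.
have [C' C'0 C'P] := linear_cnorm2_bound (invmx E).
have V0 := period_cube_gt0 nuH; set V := fine (nu Q) in V0.
(* [C] bounds the action of E, [C'] that of its inverse, and [V] is the factor in Parseval's
   identity. *)
exists (V / C'), (C * V); split; rewrite ?divr_gt0 ?mulr_gt0 // => r b ur.
pose S x k := exp_sum r b (taddN x (v k)).
pose X x j := expi (dotN (u j) x) * component r b j x.
have cX x j : cnorm2 (X x j) = cnorm2 (component r b j x).
  by rewrite cnorm2M cnorm2_expi mul1r.
have SX x k : S x k = \sum_j E j k * X x j by exact: exp_sum_shift.
have XS x j : X x j = \sum_k invmx E k j * S x k.
  transitivity ((\row_j X x j *m E *m invmx E) ord0 j); first by rewrite mulmxK // mxE.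
  rewrite mxE; apply: eq_bigr => k _; rewrite mulrC; congr (_ * _).
  by rewrite mxE SX; apply: eq_bigr => l _; rewrite mxE mulrC.
have mS k : measurable_fun setT (fun x => cnorm2 (S x k)).
  apply: (measurableT_comp (f := fun y => cnorm2 (exp_sum r b y))).
    by case: (bm_cnorm2 (cbm_exp_sum r b)).
  exact: measurable_taddN.
have mQ : measurable Q := measurable_half_open_cube _.
have mg : measurable_fun setT (fun y => (cnorm2 (exp_sum r b y))%:E).
  by apply/measurable_EFinP; case: (bm_cnorm2 (cbm_exp_sum r b)).
rewrite (integral_shifted_cubes mg) => [|x]; last by rewrite lee_fin cnorm2_ge0.
under eq_integral do rewrite sumEFin.
have mc : measurable_fun Q (fun x => \sum_j cnorm2 (component r b j x)).
  apply: measurable_sum => j; apply: measurable_funTS.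
  have : cbm (component r b j).
    by apply: cbm_sum => m; apply: cbmM; [exact: cbm_cst|exact: cbm_exp_dotN].
  by case/bm_cnorm2.
have mSs : measurable_fun Q (fun x => \sum_k cnorm2 (S x k)).
  by apply: measurable_sum => k; exact: measurable_funTS.
have ge0 (f : 'I_M -> R[i]) : 0 <= \sum_k cnorm2 (f k).
  by apply: sumr_ge0 => k _; exact: cnorm2_ge0.
have IC := integral_component b ur; split.
  rewrite mulrAC EFinM -IC muleC -ge0_integralZl //; last 3 first.
  - exact/measurable_EFinP.
  - by move=> x _; rewrite lee_fin.
  - by rewrite lee_fin invr_ge0 ltW.
  apply: ge0_le_integral => //.
  - by move=> x _; rewrite -EFinM lee_fin mulr_ge0 // invr_ge0 ltW.
  - by apply: measurable_funeM; exact/measurable_EFinP.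
  - exact/measurable_EFinP.
  - move=> x _; rewrite -EFinM lee_fin mulrC ler_pdivrMr // mulrC.
    under eq_bigr do rewrite -cX XS.
    exact: C'P.
rewrite -mulrA EFinM -IC -ge0_integralZl //; last 3 first.
- exact/measurable_EFinP.
- by move=> x _; rewrite lee_fin.
- by rewrite lee_fin ltW.
apply: ge0_le_integral => //.
- by move=> x _; rewrite lee_fin.
- exact/measurable_EFinP.
- by apply: measurable_funeM; exact/measurable_EFinP.
- move=> x _; rewrite -EFinM lee_fin.
  under [X in _ <= _ * X]eq_bigr do rewrite -cX.
  rewrite (eq_bigr (fun k => cnorm2 (\sum_j E j k * X x j))); first exact: CP.
  by move=> k _; rewrite -SX.
Qed.

End FiniteSums.

(** * Completeness of L^2 for rapidly Cauchy sequences *)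

Section RieszFischer.
Context d (T : measurableType d) (R : realType).
Variables (mu : {measure set T -> \bar R}) (D : set T).
Hypotheses (mD : measurable D) (muD : (mu D < +oo)%E).
Variables (S : nat -> T -> R[i]) (C : R).
Hypothesis bS : forall n, cbm (S n).
Hypothesis S_cauchy : forall n m, (n <= m)%N ->
  (\int[mu]_(x in D) (cnorm2 (S m x - S n x))%:E <= (C / 4 ^+ n)%:E)%E.

(** It dominates |S_{n+1} - S_n| by the inequality between arithmetic and geometric means, while the
    rate 4^-n bounds its integral by (C + mu D) / 2^n. A summable L^1 majorant is thus obtained from
    L^2 bounds alone. *)
Let step (n : nat) (x : T) : R := 2 ^+ n * cnorm2 (S n.+1 x - S n x) + (2 ^+ n)^-1.

Let cbmB F G : @cbm _ T R F -> cbm G -> cbm (fun x => F x - G x).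
Proof.
move=> bF bG; rewrite (_ : (fun x => _) = fun x => F x + -1 * G x).
  by apply: cbmD => //; apply: cbmM => //; exact: cbm_cst.
by apply/funext => x; rewrite mulN1r.
Qed.

Let bm_step n : bm (step n).
Proof.
apply: bmD; last exact: bm_cst.
by apply: bmM; [exact: bm_cst|apply: bm_cnorm2; exact: cbmB].
Qed.

Let step_ge0 n x : 0 <= step n x.
Proof.
by rewrite addr_ge0 ?mulr_ge0 ?cnorm2_ge0 ?invr_ge0 ?exprn_ge0.
Qed.

Let integral_step_le n :
  (\int[mu]_(x in D) (step n x)%:E <= (geometric (C + fine (mu D)) 2^-1 n)%:E)%E.
Proof.
have bd : bm (fun x => cnorm2 (S n.+1 x - S n x)) by apply: bm_cnorm2; exact: cbmB.
have bc : bm (fun _ : T => (2 ^+ n)^-1 : R) by exact: bm_cst.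
have := S_cauchy (leqnSn n).
rewrite !(EFin_Rintegral mD muD) // !lee_fin => dC.
rewrite RintegralD //; last 2 first.
- by apply: bm_integrable => //; apply: bmM => //; exact: bm_cst.
- exact: bm_integrable.
rewrite RintegralZl //; last exact: bm_integrable.
rewrite Rintegral_cst // /geometric /= mulrDl exprVn [fine _ * _]mulrC lerD2r.
apply: le_trans (ler_wpM2l _ dC) _; first exact: exprn_ge0.
have -> : (4 : R) = 2 * 2 by rewrite -natrM.
have e0 : (2 ^+ n : R) != 0 by rewrite expf_neq0.
rewrite exprMn; move: (2 ^+ n : R) e0 => e e0.
by rewrite (_ : e * (C / (e * e)) = C / e) //; field.
Qed.

Let ae_cauchy : \forall x \ae mu, D x ->
  cvgn (fun n => complex.Re (S n x)) /\ cvgn (fun n => complex.Im (S n x)).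
Proof.
pose g x := (\sum_(n <oo) (step n x)%:E)%E.
have mstep n : measurable_fun D (fun x => (step n x)%:E).
  by apply/measurable_EFinP; apply: measurable_funTS; case: (bm_step n).
have g0 x : (0 <= g x)%E by apply: nneseries_ge0 => n _ _; rewrite lee_fin.
have gint : mu.-integrable D g.
  apply/integrableP; split.
    by apply: (ge0_emeasurable_sum (P := xpredT)) => // n x _ _; rewrite lee_fin.
  under eq_integral do rewrite gee0_abs //.
  rewrite integral_nneseries //; last by move=> n x _; rewrite lee_fin.
  apply: (@le_lt_trans _ _ (\sum_(n <oo) (geometric (C + fine (mu D)) 2^-1 n)%:E)%E).
    apply: lee_nneseries => [n _ _|n _]; last exact: integral_step_le.
    by apply: integral_ge0 => x _; rewrite lee_fin.
  have half1 : `|2^-1 : R| < 1.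
    by rewrite ger0_norm ?invr_ge0 // invf_lt1 // ltr1n.
  rewrite (_ : (\sum_(n <oo) _)%E = ((C + fine (mu D)) / (1 - 2^-1))%:E) ?ltry //.
  apply/cvg_lim => //.
  rewrite (_ : (fun n => _) = EFin \o series (geometric (C + fine (mu D)) 2^-1)).
    by apply: cvg_EFin; [exact: nearW|exact: cvg_geometric_series].
  by apply/funext => n; rewrite /= sumEFin.
(* Where the sum of the majorants is finite, the telescoping series of [h] converges absolutely. *)
have conv (h : nat -> R) x : D x -> g x \is a fin_num ->
    (forall n, `|h n.+1 - h n| <= step n x) -> cvgn h.
  move=> Dx gx hs.
  have cs : cvgn (series (fun n => step n x)).
    apply: nnseries_is_cvg => [n|]; first exact: step_ge0.
    by rewrite -ge0_fin_numE //; exact: g0.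
  have ct : cvgn (series (telescope h)).
    apply: normed_cvg; apply: series_le_cvg cs => [n|n|n].
    - exact: normr_ge0.
    - exact: step_ge0.
    - exact: hs.
  rewrite (_ : h = fun n => h 0%N + series (telescope h) n).
    by apply: is_cvgD => //; exact: is_cvg_cst.
  by apply/funext => n; exact: eq_sum_telescope.
have le_step (t : R) (z : R[i]) n : t ^+ 2 <= cnorm2 z ->
    `|t| <= 2 ^+ n * cnorm2 z + (2 ^+ n)^-1.
  move=> tz; have e2 : (0 : R) < 2 ^+ n by rewrite exprn_gt0.
  apply: (@le_trans _ _ (2 ^+ n * t ^+ 2 + (2 ^+ n)^-1)); last first.
    by rewrite lerD2r ler_wpM2l // ltW.
  rewrite -real_normK ?num_real //; move: (`|t|) (2 ^+ n : R) e2 => a e e0.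
  rewrite -(ler_pM2l e0) mulrDr divff ?gt_eqF //.
  have := sqr_ge0 (e * a - 2^-1); nra.
have := integrable_ae mD gint; apply: filterS => x gx Dx.
have {}gx := gx Dx; split; apply: (conv _ x Dx gx) => n.
  rewrite -raddfB; apply: le_step; rewrite /cnorm2 lerDl; exact: sqr_ge0.
rewrite -raddfB; apply: le_step; rewrite /cnorm2 lerDr; exact: sqr_ge0.
Qed.

Lemma riesz_fischer : exists f : T -> R[i],
  [/\ measurable_fun D (fun x => complex.Re (f x)),
      measurable_fun D (fun x => complex.Im (f x)) &
      forall n, (\int[mu]_(x in D) (cnorm2 (f x - S n x))%:E <= (C / 4 ^+ n)%:E)%E].
Proof.
(* The upper limit is defined everywhere and measurable, and equals the limit wherever that exists;
   [fine] turns infinite values into 0. *)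
pose lsup (h : nat -> R) := fine (limn_esup (fun n => (h n)%:E)).
have lsupE h : cvgn h -> h @ \oo --> lsup h.
  move=> ch; rewrite /lsup.
  have /cvg_limn_einf_sup[_ ->] : (fun n => (h n)%:E) @ \oo --> (limn h)%:E.
    by apply: cvg_EFin => //; exact: nearW.
  exact: ch.
have mlsup (h : nat -> T -> R) : (forall n, bm (h n)) ->
    measurable_fun D (fun x => lsup (fun n => h n x)).
  move=> bh; apply: (measurableT_comp (f := fine)); first exact: fine_measurable.
  apply: measurable_fun_limn_esup => n; apply/measurable_EFinP.
  by apply: measurable_funTS; case: (bh n).
pose f x : R[i] := (lsup (fun n => complex.Re (S n x)) +i*
  lsup (fun n => complex.Im (S n x)))%C.
have mRe : measurable_fun D (fun x => complex.Re (f x)).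
  by apply: (mlsup (fun n x => complex.Re (S n x))) => n; case: (bS n).
have mIm : measurable_fun D (fun x => complex.Im (f x)).
  by apply: (mlsup (fun n x => complex.Im (S n x))) => n; case: (bS n).
exists f; split => // n.
have mSmn m : measurable_fun D (fun x => (cnorm2 (S (m + n)%N x - S n x))%:E).
  by apply/measurable_EFinP; apply: measurable_funTS;
    case: (bm_cnorm2 (cbmB (bS (m + n)%N) (bS n))).
(* Fatou's lemma with [n] fixed. Indexing by m + n makes the Cauchy bound valid for every m. *)
apply: (@le_trans _ _ (\int[mu]_(x in D)
    limn_einf (fun m => (cnorm2 (S (m + n)%N x - S n x))%:E))%E).
  apply: ae_ge0_le_integral => //.
  - by move=> x _; rewrite lee_fin cnorm2_ge0.
  - apply/measurable_EFinP; rewrite /cnorm2.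
    have [[mR _] [mI _]] := bS n.
    apply: measurable_funD; apply: measurable_funX.
      rewrite (_ : (fun x => _) = fun x => complex.Re (f x) - complex.Re (S n x)).
        by apply: measurable_funB => //; exact: measurable_funTS.
      by apply/funext => x; rewrite raddfB.
    rewrite (_ : (fun x => _) = fun x => complex.Im (f x) - complex.Im (S n x)).
      by apply: measurable_funB => //; exact: measurable_funTS.
    by apply/funext => x; rewrite raddfB.
  - move=> x _; rewrite limn_einf_lim; apply: lime_ge; first exact: is_cvg_einfs.
    by apply: nearW => m; apply: le_ereal_inf_tmp => _ [k _ <-]; rewrite lee_fin cnorm2_ge0.
  - apply: measurableT_comp => //; apply: measurable_fun_limn_esup => m.
    exact: measurableT_comp.
  apply: filterS ae_cauchy => x cx Dx; have [cR cI] := cx Dx.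
  suff /cvg_limn_einf_sup[-> _] : (fun m => (cnorm2 (S (m + n)%N x - S n x))%:E) @ \oo -->
      (cnorm2 (f x - S n x))%:E by [].
  apply: cvg_EFin; first exact: nearW.
  rewrite /cnorm2 !raddfB /=.
  rewrite (_ : _ \o _ = fun m => (complex.Re (S (m + n)%N x) - complex.Re (S n x)) ^+ 2 +
      (complex.Im (S (m + n)%N x) - complex.Im (S n x)) ^+ 2); last first.
    by apply/funext => m /=; rewrite !raddfB.
  have shift (h : nat -> R) : cvgn h -> h (m + n)%N @[m --> \oo] --> lsup h.
    by move=> ch; rewrite (cvg_shiftn n); exact: lsupE.
  apply: cvgD; rewrite expr2; under eq_fun do rewrite expr2.
    by apply: cvgM; (apply: cvgB; [exact: shift|exact: cvg_cst]).
  by apply: cvgM; (apply: cvgB; [exact: shift|exact: cvg_cst]).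
apply: le_trans (fatou mu mD mSmn _) _ => [m x _|]; first by rewrite lee_fin cnorm2_ge0.
(* The lower limit is the limit of the infima over tails, and each infimum is at most the first term
   of its tail. *)
rewrite limn_einf_lim; apply: lime_le; first exact: is_cvg_einfs.
apply: nearW => m; apply: le_trans (ereal_inf_lbound _) _; first by exists m => /=.
by apply: S_cauchy; exact: leq_addl.
Qed.

End RieszFischer.

(** * Transfer of the finite bounds to [Lambda] and [Omega] *)

Section Frame.
Variables (R : realType) (N M : nat).
Local Notation T := (N.-tuple R).
Variables (u v : 'I_M -> T) (L : 'M[R]_N) (mu : {measure set T -> \bar R}).
Hypothesis muL : is_lebesgue_measureN mu.
Hypothesis Lu : L \in unitmx.
Hypothesis u_disj : forall j k : 'I_M, j != k ->
  int_translate (u j) `&` int_translate (u k) = set0.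
Hypothesis v2pi : forall (k : 'I_M) (i : 'I_N), exists z : int,
  tnth (v k) i = 2 * pi * z%:~R.
Hypothesis Eunit : (\matrix_(j < M, k < M) expi (dotN (u j) (v k))) \in unitmx.
Local Notation I := ('I_M * N.-tuple int)%type.
Local Notation Lam := (Lambda L u).
Local Notation Om := (Omega L v).
Implicit Types (F G : set T) (a : T -> R[i]).

Definition lam (p : I) : T := mxact L^T (freq u p).

Lemma int_translateE (w : T) : int_translate w = range (fun k => taddN w (intv k)).
Proof.
apply/seteqP; split=> y [k]; first move=> ->.
  by exists k => //; apply: eq_tnthP => i; rewrite tnth_taddN !tnth_mktuple.
move=> _ <-; exists k; apply: eq_tnthP => i.
by rewrite tnth_taddN !tnth_mktuple.
Qed.

(** Disjointness of the translates determines j, and then m is determined. Sums over [Lambda] can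
    therefore be indexed by pairs (j, m) without repetition. *)
Lemma lam_inj : injective lam.
Proof.
move=> [j m] [k n] /(can_inj (mxactK _)) jmkn.
have {jmkn} : freq u (j, m) = freq u (k, n) by apply: jmkn; rewrite unitmx_tr.
rewrite /freq /= => jmkn.
have jk : j = k.
  apply/eqP; apply: contraT => /u_disj; rewrite -subset0 => /(_ (freq u (j, m))) [].
  by rewrite !int_translateE; split; [exists m|exists n].
subst k; congr (_, _); apply: eq_from_tnth => i.
have := congr1 (fun t => tnth t i) jmkn.
by rewrite !tnth_taddN !tnth_mktuple => /addrI /intr_inj.
Qed.

Lemma LambdaE : Lam = range lam.
Proof.
apply/seteqP; split=> l.
  by move=> [j [y []]]; rewrite int_translateE => -[m _ <-] ->; exists (j, m).
move=> [[j m] _ <-]; exists j, (freq u (j, m)); split => //.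
by rewrite int_translateE; exists m.
Qed.

Lemma OmegaE : Om = mxact L @^-1` shifted_cubes v.
Proof. by []. Qed.

Lemma measurable_Omega : measurable Om.
Proof.
rewrite OmegaE -[X in measurable X]setTI; apply: measurable_mxact => //.
exact: (measurable_shifted_cubes v).
Qed.

(** Folding the constant 1 onto the period cube gives M times its finite mass. *)
Lemma Omega_lty : (mu Om < +oo)%E.
Proof.
have [nu nuE] := image_measure_exists mu (measurable_mxact L).
have nuH := haarlike_image muL Lu nuE.
have -> : mu Om = nu (shifted_cubes v) by rewrite nuE.
have := integral_shifted_cubes nuH v2pi Eunit (g := fun=> 1%E) _ _.
rewrite integral_cst; last exact: (measurable_shifted_cubes v).
rewrite mul1e => -> //.
under eq_integral do rewrite sumEFin.
rewrite integral_cst; last exact: measurable_half_open_cube.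
by rewrite lte_mul_pinfty ?period_cube_lty // lee_fin sumr_ge0.
Qed.

Lemma cbm_exp_partial_sum F a : finite_set F -> cbm (exp_partial_sum F a).
Proof.
move=> finF; rewrite (_ : exp_partial_sum F a =
    fun x => \sum_(l <- finmap.enum_fset (fset_set F)) a l * expi (dotN l x)).
  apply: cbm_sum => l; apply: cbmM; [exact: cbm_cst|exact: cbm_exp_dotN].
by apply/funext => x; rewrite /exp_partial_sum fsbig_finite.
Qed.

Definition sqnorm F a : R := \sum_(l \in F) cnorm2 (a l).

(** By adjunction, a finite sum over [Lambda] is an [exp_sum] composed with L, so its integral over
    [Omega] is one against the image measure. *)
Lemma riesz_bounds : exists c1 c2, [/\ 0 < c1, 0 < c2 &
  forall F a, finite_set F -> F `<=` Lam ->
    ((c1 * sqnorm F a)%:E <=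
      \int[mu]_(x in Om) (cnorm2 (exp_partial_sum F a x))%:E)%E /\
    (\int[mu]_(x in Om) (cnorm2 (exp_partial_sum F a x))%:E <=
      (c2 * sqnorm F a)%:E)%E].
Proof.
have [nu nuE] := image_measure_exists mu (measurable_mxact L).
have nuH := haarlike_image muL Lu nuE.
have [c1 [c2 [c10 c20 cP]]] := exp_sum_bounds nuH v2pi Eunit.
exists c1, c2; split => // F a finF FL.
pose G := lam @^-1` F.
have finG : finite_set G by apply: finite_preimage => // x y _ _; exact: lam_inj.
have FG : F = lam @` G.
  apply/seteqP; split=> [l Fl|_ [p Gp <-] //].
  by have := FL _ Fl; rewrite LambdaE => -[p _ pl]; exists p; rewrite // /G /= pl.
have sumE (V : nmodType) (h : T -> V) :
    \sum_(l \in F) h l = \sum_(p <- finmap.enum_fset (fset_set G)) h (lam p).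
  rewrite FG fsbig_image; first by rewrite fsbig_finite.
  by move=> x y _ _; exact: lam_inj.
have := cP (finmap.enum_fset (fset_set G)) (a \o lam) (finmap.fset_uniq _).
rewrite nuE ge0_integral_pushforward; last first.
- by move=> y _; rewrite lee_fin cnorm2_ge0.
- apply/measurable_EFinP; apply: measurable_funTS.
  by case: (bm_cnorm2 (cbm_exp_sum u (finmap.enum_fset (fset_set G)) (a \o lam))).
- exact: (measurable_shifted_cubes v).
- exact: measurable_mxact.
rewrite /sqnorm sumE.
suff -> : (fun x => (cnorm2 (exp_partial_sum F a x))%:E) =
    (fun y => (cnorm2 (exp_sum u (finmap.enum_fset (fset_set G)) (a \o lam) y))%:E)
      \o mxact L by [].
apply/funext => x /=; congr (cnorm2 _)%:E.
rewrite /exp_partial_sum sumE; apply: eq_bigr => p _.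
by rewrite /lam dotN_mxact.
Qed.

End Frame.

(** * Integrals of squared moduli *)

Section SquareIntegrals.
Context d (T : measurableType d) (R : realType).
Variables (mu : {measure set T -> \bar R}) (D : set T).
Hypothesis mD : measurable D.
Implicit Types f g : T -> R[i].

Definition cmeasurable f :=
  measurable_fun D (fun x => complex.Re (f x)) /\
  measurable_fun D (fun x => complex.Im (f x)).

Lemma cbm_cmeasurable f : cbm f -> cmeasurable f.
Proof. by move=> [[mR _] [mI _]]; split; exact: measurable_funTS. Qed.

Lemma cmeasurableB f g : cmeasurable f -> cmeasurable g ->
  cmeasurable (fun x => f x - g x).
Proof.
move=> [fR fI] [gR gI]; split.
  rewrite (_ : (fun x => _) = fun x => complex.Re (f x) - complex.Re (g x)).
    exact: measurable_funB.
  by apply/funext => x; rewrite raddfB.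
rewrite (_ : (fun x => _) = fun x => complex.Im (f x) - complex.Im (g x)).
  exact: measurable_funB.
by apply/funext => x; rewrite raddfB.
Qed.

Lemma measurable_cnorm2 f : cmeasurable f ->
  measurable_fun D (fun x => (cnorm2 (f x))%:E).
Proof.
by move=> [fR fI]; apply/measurable_EFinP; apply: measurable_funD; exact: measurable_funX.
Qed.

Lemma integral_cnorm2_le f g : cmeasurable f -> cmeasurable g ->
  (\int[mu]_(x in D) (cnorm2 (f x))%:E <= 2%:E * \int[mu]_(x in D) (cnorm2 (g x))%:E +
     2%:E * \int[mu]_(x in D) (cnorm2 (f x - g x))%:E)%E.
Proof.
move=> mf mg; have mfg := cmeasurableB mf mg.
have c0 h x : D x -> (0 <= (cnorm2 (h x : R[i]))%:E)%E.
  by move=> _; rewrite lee_fin cnorm2_ge0.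
have c20 h x : D x -> (0 <= 2%:E * (cnorm2 (h x : R[i]))%:E)%E.
  by move=> _; rewrite -EFinM lee_fin mulr_ge0 // cnorm2_ge0.
rewrite -!ge0_integralZl ?lee_fin //; try exact: measurable_cnorm2;
  [|exact: c0|exact: c0].
rewrite -ge0_integralD //; last 4 first.
- exact: c20.
- by apply: measurable_funeM; exact: measurable_cnorm2.
- exact: c20.
- by apply: measurable_funeM; exact: measurable_cnorm2.
apply: ge0_le_integral => //.
- exact: c0.
- exact: measurable_cnorm2.
- by apply: emeasurable_funD; apply: measurable_funeM; exact: measurable_cnorm2.
- by move=> x _; rewrite -!EFinM -EFinD lee_fin cnorm2B_le.
Qed.

End SquareIntegrals.

(** * From finite sums to square summable families *)

Section FrameConsequences.
Variables (R : realType) (N : nat).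
Local Notation T := (N.-tuple R).
Variables (mu : {measure set T -> \bar R}) (D Lam : set T) (c1 c2 : R).
Hypotheses (mD : measurable D) (muD : (mu D < +oo)%E) (c10 : 0 < c1) (c20 : 0 < c2).
Hypothesis bounds : forall (F : set T) (a : T -> R[i]), finite_set F -> F `<=` Lam ->
  ((c1 * sqnorm F a)%:E <=
    \int[mu]_(x in D) (cnorm2 (exp_partial_sum F a x))%:E)%E /\
  (\int[mu]_(x in D) (cnorm2 (exp_partial_sum F a x))%:E <=
    (c2 * sqnorm F a)%:E)%E.
Implicit Types (F G U : set T) (a : T -> R[i]).

(** Brings sums over different finite sets to a common index set, where they combine term by
    term. *)
Lemma fsum_indic (V : nmodType) F U (h : T -> V) : finite_set U -> F `<=` U ->
  \sum_(l \in F) h l =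
  \sum_(l <- finmap.enum_fset (fset_set U)) (if l \in F then h l else 0).
Proof.
by move=> finU FU; rewrite -[in LHS](setIidr FU) fsbig_mkcondr fsbig_finite.
Qed.

Lemma sqnorm_mono F U a : finite_set U -> F `<=` U -> sqnorm F a <= sqnorm U a.
Proof.
move=> fU FU; rewrite /sqnorm (fsum_indic _ fU FU) fsbig_finite //.
by apply: ler_sum => l _; case: ifP => // _; exact: cnorm2_ge0.
Qed.

Lemma sqnorm_le_sqsum F a : finite_set F -> F `<=` Lam ->
  ((sqnorm F a)%:E <= sqsum Lam a)%E.
Proof.
move=> fF FL; rewrite /sqnorm -fsumEFin //.
by apply: ereal_sup_ubound; exists F.
Qed.

(** The difference has coefficients a or -a on the symmetric difference of F and G, whose square
    norm is the combination on the right. It is small once F and G both nearly exhaust the total. *)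
Lemma integral_partial_sum_sub F G a : finite_set F -> finite_set G ->
  F `<=` Lam -> G `<=` Lam ->
  (\int[mu]_(x in D) (cnorm2 (exp_partial_sum F a x - exp_partial_sum G a x))%:E <=
   (c2 * (2 * sqnorm (F `|` G) a - sqnorm F a - sqnorm G a))%:E)%E.
Proof.
move=> fF fG FL GL; set U := F `|` G.
have fU : finite_set U by rewrite finite_setU.
have UL : U `<=` Lam by move=> l [/FL|/GL].
have FU : F `<=` U by exact: subsetUl.
have GU : G `<=` U by exact: subsetUr.
pose b l := (if l \in F then a l else 0) - (if l \in G then a l else 0).
have -> : 2 * sqnorm U a - sqnorm F a - sqnorm G a = sqnorm U b.
  rewrite /sqnorm (fsum_indic _ fU FU) (fsum_indic _ fU GU) !(fsbig_finite _ _ fU).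
  rewrite mulr_sumr -!sumrB; apply: eq_big_seq => l.
  rewrite in_fset_set // inE /b => -[Fl|Gl].
    rewrite (mem_set Fl); case: ifP => _; first by rewrite subrr cnorm20; ring.
    by rewrite !subr0; ring.
  rewrite (mem_set Gl); case: ifP => _; first by rewrite subrr cnorm20; ring.
  by rewrite sub0r cnorm2N; ring.
rewrite (eq_integral (fun x => (cnorm2 (exp_partial_sum U b x))%:E)).
  exact: (bounds b fU UL).2.
move=> x _; congr (cnorm2 _)%:E.
rewrite /exp_partial_sum (fsum_indic _ fU FU) (fsum_indic _ fU GU) (fsbig_finite _ _ fU).
rewrite -sumrB; apply: eq_bigr => l _; rewrite /b mulrBl.
by do 2 case: ifP => _; rewrite ?mul0r.
Qed.

Lemma sqsum_approx a : square_summable Lam a -> forall e, 0 < e ->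
  exists F, [/\ finite_set F, F `<=` Lam & fine (sqsum Lam a) - sqnorm F a <= e].
Proof.
move=> sa e e0.
have sfin : sqsum Lam a \is a fin_num.
  by rewrite ge0_fin_numE //; apply: esum_ge0 => l _; rewrite lee_fin cnorm2_ge0.
have [x [F [fF FL] <-]] := ub_ereal_sup_adherent e0 sfin.
rewrite fsumEFin // -/(sqnorm F a) -[ereal_sup _]fineK // -EFinB lte_fin => h.
by exists F; split => //; rewrite lerBlDr -lerBlDl ltW.
Qed.

Lemma L2_exp_sum_exists a : square_summable Lam a ->
  exists f, L2_exp_sum mu D Lam a f.
Proof.
move=> sa; set s := fine (sqsum Lam a).
have sfin : sqsum Lam a \is a fin_num.
  by rewrite ge0_fin_numE //; apply: esum_ge0 => l _; rewrite lee_fin cnorm2_ge0.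
have As F : finite_set F -> F `<=` Lam -> sqnorm F a <= s.
  by move=> fF FL; rewrite -lee_fin fineK //; exact: sqnorm_le_sqsum.
have e4 n : (0 : R) < (4 ^+ n)^-1 by rewrite invr_gt0 exprn_gt0.
(* Tails of size 4^-n give the rate that [riesz_fischer] asks for, with constant 2 * c2. *)
have [F FP] := choice (fun n => sqsum_approx sa (e4 n)).
pose S n := exp_partial_sum (F n) a.
have bS n : cbm (S n) by apply: cbm_exp_partial_sum; have [] := FP n.
have sub G n e : finite_set G -> G `<=` Lam -> s - sqnorm G a <= e ->
    (\int[mu]_(x in D) (cnorm2 (exp_partial_sum G a x - S n x))%:E <=
      (c2 * (e + (4 ^+ n)^-1))%:E)%E.
  move=> fG GL Ge; have [fF FL Fn] := FP n.
  apply: le_trans (integral_partial_sum_sub a fG fF GL FL) _.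
  rewrite lee_fin; apply: ler_wpM2l; first exact: ltW.
  have : sqnorm (G `|` F n) a <= s.
    by apply: As; [rewrite finite_setU|move=> l [/GL|/FL]].
  by move: Fn Ge; rewrite -/s; move: ((4 ^+ n)^-1 : R) => q; lra.
have cauchy n m : (n <= m)%N ->
    (\int[mu]_(x in D) (cnorm2 (S m x - S n x))%:E <= (2 * c2 / 4 ^+ n)%:E)%E.
  move=> nm; have [fF FL Fm] := FP m.
  apply: le_trans (sub _ n _ fF FL Fm) _; rewrite lee_fin -mulrA mulrCA ler_pM2l //.
  rewrite mulrDl !mul1r lerD2r lef_pV2 ?posrE ?exprn_gt0 //.
  by rewrite ler_weXn2l // ler1n.
have [f [mR mI fS]] := riesz_fischer mD muD bS cauchy.
exists f; split => // e e0.
(* Both the limit and any larger finite sum are within 2 * c2 / 4^n of [S n] in square integral;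
   doubling and adding the two errors gives 8 * c2 / 4^n. *)
have [n ne] : exists n, 8 * c2 / 4 ^+ n < e.
  exists (Num.truncn (8 * c2 / e)); rewrite ltr_pdivrMr ?exprn_gt0 //.
  rewrite [e * _]mulrC -ltr_pdivrMr //; apply: lt_le_trans (truncnS_gt _) _.
  elim: (Num.truncn _) => [//|n IH].
  by rewrite exprS -[n.+2%:R]natr1; have : (1 : R) <= 4 ^+ n; [rewrite exprn_ege1 // ler1n|lra].
have [fF FL Fn] := FP n.
exists (F n) => // G fG FG GL.
have mf : cmeasurable D f by [].
have mG : cmeasurable D (exp_partial_sum G a).
  by apply: cbm_cmeasurable; exact: cbm_exp_partial_sum.
have mS : cmeasurable D (S n) by exact: cbm_cmeasurable.
have := integral_cnorm2_le mu mD (cmeasurableB mf mG) (cmeasurableB mf mS).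
move=> /le_lt_trans; apply.
have Gn : s - sqnorm G a <= (4 ^+ n)^-1.
  by apply: le_trans Fn; rewrite lerB // sqnorm_mono.
have -> : (\int[mu]_(x in D) (cnorm2 (f x - exp_partial_sum G a x - (f x - S n x)))%:E =
   \int[mu]_(x in D) (cnorm2 (exp_partial_sum G a x - S n x))%:E)%E.
  apply: eq_integral => x _; rewrite -cnorm2N; congr (cnorm2 _)%:E.
  by ring.
apply: (@le_lt_trans _ _ (8 * c2 / 4 ^+ n)%:E); last by rewrite lte_fin.
have -> : 8 * c2 / 4 ^+ n = 2 * (2 * c2 / 4 ^+ n) + 2 * (c2 * ((4 ^+ n)^-1 + (4 ^+ n)^-1)).
  by move: ((4 ^+ n)^-1 : R) => q; ring.
rewrite [X in (_ <= X)%E]EFinD; apply: leeD; rewrite [X in (_ <= X)%E]EFinM;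
  (apply: lee_wpmul2l; first by rewrite lee_fin).
  exact: fS.
exact: sub.
Qed.

(** Passing from a partial sum to its limit costs a factor 2 in each direction, up to an arbitrarily
    small error. *)
Lemma two_sided_estimate_of_bounds : two_sided_estimate mu D Lam (c1 / 2) (2 * c2).
Proof.
move=> a sa f [mR mI fS]; have mf : cmeasurable D f by [].
have sfin : sqsum Lam a \is a fin_num.
  by rewrite ge0_fin_numE //; apply: esum_ge0 => l _; rewrite lee_fin cnorm2_ge0.
have mF F : finite_set F -> cmeasurable D (exp_partial_sum F a).
  by move=> fF; apply: cbm_cmeasurable; exact: cbm_exp_partial_sum.
split.
  have c12 : 0 < c1 / 2 by rewrite divr_gt0.
  apply/lee_addgt0Pr => e e0.
  have [F0 [fF0 F0L] F0P] := fS e e0.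
  case: (leP +oo%E (\int[mu]_(x in D) (cnorm2 (f x))%:E)%E) => [|Ify].
    by rewrite leye_eq => /eqP ->; rewrite addye ?leey.
  have Ifin : (\int[mu]_(x in D) (cnorm2 (f x))%:E)%E \is a fin_num.
    by rewrite ge0_fin_numE //; apply: integral_ge0 => x _; rewrite lee_fin cnorm2_ge0.
  rewrite -(fineK Ifin) -(fineK sfin) -EFinM -[X in (_ <= X)%E]EFinD lee_fin.
  set J := fine _; rewrite mulrC -ler_pdivlMr //.
  rewrite -lee_fin fineK //; apply: ge_ereal_sup => _ [X [fX XL] <-].
  rewrite fsumEFin // -/(sqnorm X a) lee_fin.
  (* Enlarging [X] by [F0] makes the partial sum close to [f] and can only increase the square
     norm. *)
  have fU : finite_set (X `|` F0) by rewrite finite_setU.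
  have UL : X `|` F0 `<=` Lam by move=> l [/XL|/F0L].
  apply: le_trans (sqnorm_mono a fU (@subsetUl _ X F0)) _.
  have := F0P _ fU (@subsetUr _ X F0) UL.
  have := integral_cnorm2_le mu mD (mF _ fU) mf.
  under [X in (_ <= _ + _ * X)%E -> _]eq_integral do rewrite cnorm2B.
  move=> h1 h2; rewrite ler_pdivlMr //.
  have : ((c1 * sqnorm (X `|` F0) a)%:E <=
      2%:E * \int[mu]_(x in D) (cnorm2 (f x))%:E + 2%:E * e%:E)%E.
    apply: le_trans (bounds a fU UL).1 _; apply: le_trans h1 _; apply: leeD => //.
    by apply: lee_wpmul2l; [rewrite lee_fin|exact: ltW].
  rewrite -(fineK Ifin) -!EFinM -[X in (_ <= X)%E]EFinD -/J.
  rewrite lee_fin; lra.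
apply/lee_addgt0Pr => e e0.
have e20 : 0 < e / 2 by rewrite divr_gt0.
have [F0 [fF0 F0L] F0P] := fS (e / 2) e20.
have h1 := F0P _ fF0 (@subset_refl _ F0) F0L.
apply: le_trans (integral_cnorm2_le mu mD mf (mF _ fF0)) _.
rewrite [X in (_ <= _ + X)%E](_ : e%:E = 2%:E * (e / 2)%:E)%E; last first.
  by rewrite -EFinM mulrC divfK.
apply: leeD; last by apply: lee_wpmul2l; [rewrite lee_fin|exact: ltW].
rewrite EFinM -muleA; apply: lee_wpmul2l; first by rewrite lee_fin.
apply: le_trans (bounds a fF0 F0L).2 _.
rewrite EFinM; apply: lee_wpmul2l; first by rewrite lee_fin ltW.
exact: sqnorm_le_sqsum.
Qed.

End FrameConsequences.

(** * Cosine near zero and away from the multiples of 2 pi *)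

Section Cosine.
Variable R : realType.
Implicit Types t e : R.

Lemma cos_near0 e : 0 < e ->
  exists2 r : R, 0 < r & forall t, `|t| < r -> 1 - cos t <= e.
Proof.
move=> e0; have /cvgrPdist_le /(_ e e0) := @continuous_cos R 0.
move=> /nbhs_ballP [r /= r0 rP]; exists r => // t tr.
have := rP t; rewrite /ball /= sub0r normrN cos0 => /(_ tr).
by apply: le_trans; exact: ler_norm.
Qed.

Lemma cos_far e t : 0 <= e <= pi -> e <= `|t| <= 2 * pi - e -> cos t <= cos e.
Proof.
move=> /andP[e0 epi] /andP[et te]; rewrite -(cos_norm t).
have eI : e \in `[0, pi] by rewrite in_itv /= e0.
have [tpi|tpi] := leP `|t| pi.
  by rewrite leNgt ltr_cos ?in_itv /= ?normr_ge0 // -leNgt.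
(* Reflection brings the argument back to [0, pi], where cosine decreases. *)
have -> : cos `|t| = cos (2 * pi - `|t|).
  by rewrite -[RHS]cosN opprB mulr_natl -[RHS]cosD2pi subrK.
rewrite leNgt ltr_cos //; first by rewrite -leNgt lerBrDl -lerBrDr.
by rewrite in_itv /=; apply/andP; split; lra.
Qed.

End Cosine.

(** * Trigonometric polynomials peaked at a point *)

Section TrigPolynomials.
Variables (R : realType) (N : nat).
Local Notation T := (N.-tuple R).
Implicit Types (f g : T -> R[i]).

(** Repeated frequencies are allowed, which makes closure under sums and products immediate;
    [trig_poly_uniq] merges them before Parseval's identity is used. *)
Definition trig_poly f := exists s : seq (R[i] * N.-tuple int), forall y,
  f y = \sum_(q <- s) q.1 * expi (dotN (intv q.2) y).

Lemma trig_poly_cst c : trig_poly (fun=> c).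
Proof.
exists [:: (c, [tuple 0 | i < N])] => y; rewrite big_seq1 /dotN big1 ?expi0 ?mulr1 // => i _.
by rewrite !tnth_mktuple mul0r.
Qed.

Lemma trig_polyD f g : trig_poly f -> trig_poly g -> trig_poly (fun y => f y + g y).
Proof.
by move=> [s fs] [t gt]; exists (s ++ t) => y; rewrite big_cat fs gt.
Qed.

Lemma trig_polyM f g : trig_poly f -> trig_poly g -> trig_poly (fun y => f y * g y).
Proof.
move=> [s fs] [t gt].
exists [seq (p.1 * q.1, [tuple tnth p.2 i + tnth q.2 i | i < N]) | p <- s, q <- t] => y.
rewrite big_allpairs_dep fs gt mulr_suml; apply: eq_bigr => p _.
rewrite mulr_sumr; apply: eq_bigr => q _ /=.
have -> : dotN (intv [tuple tnth p.2 i + tnth q.2 i | i < N]) y =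
    dotN (intv p.2) y + dotN (intv q.2) y.
  rewrite /dotN -big_split; apply: eq_bigr => i _ /=.
  by rewrite !tnth_mktuple intrD mulrDl.
by rewrite expiD mulrACA.
Qed.

Lemma trig_poly_exp f n : trig_poly f -> trig_poly (fun y => f y ^+ n).
Proof.
move=> tf; elim: n => [|n IH]; first exact: trig_poly_cst.
by under eq_fun do rewrite exprS; exact: trig_polyM.
Qed.

Lemma trig_poly_sum (I : Type) (r : seq I) (f : I -> T -> R[i]) :
  (forall i, trig_poly (f i)) -> trig_poly (fun y => \sum_(i <- r) f i y).
Proof.
move=> tf; elim: r => [|i r IH].
  by under eq_fun do rewrite big_nil; exact: trig_poly_cst.
by under eq_fun do rewrite big_cons; exact: trig_polyD.
Qed.

Lemma cos_expi (t : R) : (cos t)%:C%C = 2^-1 * expi t + 2^-1 * expi (- t).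
Proof.
rewrite -mulrDr expiN addcJ mulrA mulVf ?mul1r //.
Qed.

Lemma trig_poly_cos (i : 'I_N) (c : R) :
  trig_poly (fun y => (cos (tnth y i - c))%:C%C).
Proof.
pose ax s : N.-tuple int := [tuple if j == i then s else 0 | j < N].
exists [:: (2^-1 * expi (- c), ax 1); (2^-1 * expi c, ax (-1))] => y.
have dax s : dotN (intv (ax s)) y = s%:~R * tnth y i.
  rewrite /dotN (bigD1 i) //= big1 => [|j ji].
    by rewrite !tnth_mktuple eqxx addr0.
  by rewrite !tnth_mktuple (negbTE ji) mul0r.
rewrite big_cons big_seq1 /= !dax -!mulrA -!expiD cos_expi.
by congr (_ * expi _ + _ * expi _); rewrite ?mulrN1z /=; lra.
Qed.

Lemma trig_poly_uniq f : trig_poly f ->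
  exists (r : seq (N.-tuple int)) (b : N.-tuple int -> R[i]), uniq r /\
    forall y, f y = \sum_(m <- r) b m * expi (dotN (intv m) y).
Proof.
move=> [s fs]; exists (undup [seq q.2 | q <- s]).
exists (fun m => \sum_(q <- s | q.2 == m) q.1); split; first exact: undup_uniq.
move=> y; rewrite fs; under [RHS]eq_bigr do rewrite mulr_suml.
rewrite (exchange_big_dep xpredT) //= [LHS]big_seq [RHS]big_seq; apply: eq_bigr => q qs.
rewrite (eq_bigl (pred1 q.2)) => [|m]; last by rewrite /= eq_sym.
rewrite -big_filter filter_pred1_uniq ?undup_uniq ?big_seq1 // mem_undup.
by apply: map_f.
Qed.

Variable z0 : T.

(** Nonnegative, with maximum 1 + 2 N attained exactly at z0 modulo the period; its powers serve as
    the polynomial P of the overview. *)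
Definition bump (y : T) : R := 1 + \sum_(i < N) (1 + cos (tnth y i - tnth z0 i)).

Lemma trig_poly_bump n : trig_poly (fun y => (bump y ^+ n)%:C%C).
Proof.
under eq_fun do rewrite rmorphXn /=.
apply: trig_poly_exp; rewrite /bump.
under eq_fun do rewrite rmorphD rmorph_sum /=.
apply: trig_polyD; first exact: trig_poly_cst.
apply: trig_poly_sum => i; under eq_fun do rewrite rmorphD /=.
by apply: trig_polyD; [exact: trig_poly_cst|exact: trig_poly_cos].
Qed.

Lemma bump_ge0 y : 0 <= bump y.
Proof.
apply: addr_ge0 => //; apply: sumr_ge0 => i _.
by rewrite -lerBlDl sub0r cos_geN1.
Qed.

Lemma bump_near (e : R) (y : T) :
  (forall i, 1 - cos (tnth y i - tnth z0 i) <= e) ->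
  1 + 2 * N%:R - N%:R * e <= bump y.
Proof.
move=> ye; rewrite /bump -addrA lerD2l.
have -> : 2 * N%:R - N%:R * e = \sum_(i < N) (2 - e) :> R.
  by rewrite sumr_const card_ord -mulr_natl; ring.
by apply: ler_sum => i _; have := ye i; lra.
Qed.

Lemma bump_far (e : R) (y : T) (i : 'I_N) :
  cos (tnth y i - tnth z0 i) <= e -> bump y <= 2 * N%:R + e.
Proof.
move=> ye; rewrite /bump (bigD1 i) //=.
have : \sum_(j < N | j != i) (1 + cos (tnth y j - tnth z0 j)) <=
    \sum_(j < N | j != i) (2 : R).
  by apply: ler_sum => j _; have := cos_le1 (tnth y j - tnth z0 j); lra.
have <- : 2 + \sum_(j < N | j != i) (2 : R) = 2 * N%:R.
  by rewrite -(bigD1 (P := xpredT) (F := fun=> 2) i) //= sumr_const card_ord mulr_natr.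
by lra.
Qed.

Lemma bump_shift (y w : T) :
  (forall i, exists z : int, tnth w i = 2 * pi * z%:~R) ->
  bump (taddN y w) = bump y.
Proof.
move=> wP; rewrite /bump; congr (_ + _); apply: eq_bigr => i _; congr (_ + _).
have [z wz] := wP i; rewrite tnth_taddN wz addrAC.
have : expi (tnth y i - tnth z0 i + 2 * pi * z%:~R) = expi (tnth y i - tnth z0 i).
  by rewrite expiD expi_2pi_int mulr1.
by move=> /(congr1 (@complex.Re R)).
Qed.

Lemma bm_bump n : bm (fun y => bump y ^+ n).
Proof.
elim: n => [|n IH]; first by under eq_fun do rewrite expr0; exact: bm_cst.
under eq_fun do rewrite exprS; apply: bmM => //.
apply: bmD; first exact: bm_cst.
elim: (index_enum _) => [|i r IHr]; first by under eq_fun do rewrite big_nil; exact: bm_cst.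
under eq_fun do rewrite big_cons; apply: bmD => //.
apply: bmD; first exact: bm_cst.
apply: bm_cos; apply: measurable_funB => //; exact: measurable_tnth_fun.
Qed.

End TrigPolynomials.

Lemma geometric_gap (R : realType) (q q' A B : R) : 0 <= q -> q < q' -> 0 < A ->
  exists n, B * q ^+ n < A * q' ^+ n.
Proof.
move=> q0 qq' A0; have q'0 : 0 < q' by exact: le_lt_trans qq'.
have B0 : 0 < `|B| + 1 by rewrite ltr_wpDl.
have ratio : `|q / q'| < 1.
  rewrite ger0_norm; last by apply: divr_ge0 => //; exact: ltW.
  by rewrite ltr_pdivrMr // mul1r.
have /cvgrPdist_lt /(_ (A / (`|B| + 1)) (divr_gt0 A0 B0)) := cvg_expr ratio.
move=> [n _ /(_ n (leqnn n))]; rewrite sub0r normrN expr_div_n => hn; exists n.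
have q'n : 0 < q' ^+ n by rewrite exprn_gt0.
have := le_lt_trans (ler_norm _) hn.
rewrite ltr_pdivrMr // mulrAC ltr_pdivlMr // => h.
apply: le_lt_trans h; rewrite mulrC ler_wpM2l ?exprn_ge0 //.
by apply: le_trans (ler_norm _) _; rewrite lerDl.
Qed.

(** * Failure of the lower bound after removal of an open set *)

Section Removal.
Variables (R : realType) (N M : nat).
Local Notation T := (N.-tuple R).
Variables (u v : 'I_M -> T) (L : 'M[R]_N) (mu : {measure set T -> \bar R}).
Hypothesis muL : is_lebesgue_measureN mu.
Hypothesis Lu : L \in unitmx.
Hypothesis u_disj : forall j k : 'I_M, j != k ->
  int_translate (u j) `&` int_translate (u k) = set0.
Hypothesis v2pi : forall (k : 'I_M) (i : 'I_N), exists z : int,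
  tnth (v k) i = 2 * pi * z%:~R.
Let E := \matrix_(j < M, k < M) expi (dotN (u j) (v k)).
Hypothesis Eunit : E \in unitmx.
Local Notation I := ('I_M * N.-tuple int)%type.
Local Notation Lam := (Lambda L u).
Local Notation Q := (half_open_cube N (2 * pi : R)).

Let lamI := lam_inj Lu u_disj.

(** Tests the estimate on a finitely supported family, for which the finite sum itself is an L^2
    sum. *)
Lemma two_sided_estimate_exp_sum (D : set T) (c1 c2 : R) (s : seq I) (b : I -> R[i]) :
  measurable D -> 0 < c1 -> two_sided_estimate mu D Lam c1 c2 -> uniq s ->
  ((c1 * \sum_(p <- s) cnorm2 (b p))%:E <=
    \int[mu]_(x in D) (cnorm2 (exp_sum u s b (mxact L x)))%:E)%E.
Proof.
move=> mD c10 est us; pose F : set T := lam u L @` [set` s].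
(* At most one term is present, because [lam u L] is injective and [s] has no repetition; summing
   over the fibre avoids inverting [lam]. *)
pose a l := \sum_(p <- s | lam u L p == l) b p.
have fF : finite_set F by apply: finite_image; exact: finite_seq.
have FL : F `<=` Lam by move=> _ [p _ <-]; rewrite LambdaE; exists p.
have sumF (V : nmodType) (h : T -> V) : \sum_(l \in F) h l = \sum_(p <- s) h (lam u L p).
  by rewrite fsbig_image -?fsbig_seq // => x y _ _; exact: lamI.
have aE p : p \in s -> a (lam u L p) = b p.
  move=> ps; rewrite /a (eq_bigl (pred1 p)) => [|q]; last by rewrite /= (inj_eq lamI).
  by rewrite -big_filter filter_pred1_uniq // big_seq1.
have a0 l : ~ F l -> a l = 0.
  move=> Fl; rewrite /a big_seq_cond big1 // => p /andP[ps /eqP pl].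
  by case: Fl; exists p.
have sE : sqnorm F a = \sum_(p <- s) cnorm2 (b p).
  by rewrite /sqnorm sumF; apply: eq_big_seq => p ps; rewrite aE.
have sumE : sqsum Lam a = (sqnorm F a)%:E.
  rewrite /sqsum (esumID F) => [|l _]; last by rewrite lee_fin cnorm2_ge0.
  rewrite [X in (_ + X)%E]esum1 => [|l [_ Fl]]; last by rewrite a0 // cnorm20.
  rewrite adde0 setIidr // esum_fset // => [|l _]; last by rewrite lee_fin cnorm2_ge0.
  by rewrite fsumEFin.
have psE G x : F `<=` G -> exp_partial_sum G a x = exp_partial_sum F a x.
  move=> FG; apply/esym/fsbig_widen => // l [_ Fl] /=.
  by rewrite a0 // mul0r.
have sa : square_summable Lam a by rewrite /square_summable sumE ltry.
have L2a : L2_exp_sum mu D Lam a (exp_partial_sum F a).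
  have [mR mI] := cbm_cmeasurable D (cbm_exp_partial_sum a fF).
  split => // e e0; exists F => // G fG FG GL.
  rewrite (eq_integral (fun=> 0%E)) ?integral0 ?lte_fin // => x _.
  by rewrite psE // subrr cnorm20.
have [c1f _] := est a sa _ L2a.
move: c1f; rewrite sumE sE -EFinM => /le_trans; apply.
rewrite le_eqVlt; apply/orP; left; apply/eqP; apply: eq_integral => x _.
congr (cnorm2 _)%:E; rewrite /exp_partial_sum sumF /exp_sum.
by apply: eq_big_seq => p ps; rewrite aE // /lam dotN_mxact.
Qed.

Lemma cnorm2_expi_sub1 (t : R) : cnorm2 (expi t - 1) = 2 * (1 - cos t).
Proof.
rewrite /cnorm2 /expi /= subr0 sin2cos2; ring.
Qed.

Lemma near_dotN (w : T) (r : R) : 0 < r -> exists2 d : R, 0 < d &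
  forall h : T, (forall i, `|tnth h i| < d) -> `|dotN w h| < r.
Proof.
move=> r0; pose B := 1 + \sum_(i < N) `|tnth w i|.
have B0 : 0 < B by rewrite ltr_pwDl // sumr_ge0.
exists (r / B); first by rewrite divr_gt0.
move=> h hd; rewrite /dotN.
apply: (@le_lt_trans _ _ ((\sum_(i < N) `|tnth w i|) * (r / B))).
  apply: le_trans (ler_norm_sum _ _ _) _; rewrite mulr_suml; apply: ler_sum => i _.
  by rewrite normrM; apply: ler_wpM2l => //; exact/ltW/hd.
by rewrite mulrCA gtr_pMr // ltr_pdivrMr // mul1r /B ltrDr.
Qed.

Lemma near_dotN_family (K : nat) (w : 'I_K -> T) (r : R) : 0 < r ->
  exists2 d : R, 0 < d & forall h : T, (forall i, `|tnth h i| < d) ->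
    forall j, `|dotN (w j) h| < r.
Proof.
move=> r0.
have hj j : exists d, 0 < d /\ forall h : T, (forall i, `|tnth h i| < d) ->
    `|dotN (w j) h| < r.
  by have [d d0 dP] := near_dotN (w j) r0; exists d.
have [d dP] := choice hj.
exists (\big[Num.min/1]_(j < K) d j).
  by apply: lt_bigmin => // j _; exact: (dP j).1.
move=> h hd j; apply: (dP j).2 => i; apply: lt_le_trans (hd i) _.
exact: bigmin_le.
Qed.

Lemma near_mxact (A : 'M[R]_N) (r : R) : 0 < r -> exists2 d : R, 0 < d &
  forall h : T, (forall i, `|tnth h i| < d) -> forall i, `|tnth (mxact A h) i| < r.
Proof.
move=> r0; have [d d0 dP] := near_dotN_family (fun i => [tuple A i j | j < N]) r0.
exists d => // h hd i; have := dP h hd i; rewrite tnth_mxact /dotN.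
by under eq_bigr do rewrite tnth_mktuple.
Qed.

Lemma two_sided_estimate_removal (w : set T) (c1 c2 : R) :
  is_openN w -> w !=set0 -> w `<=` Omega L v -> 0 < c1 ->
  ~ two_sided_estimate mu (Omega L v `\` w) Lam c1 c2.
Proof.
move=> ow [x0 wx0] wO c10 est.
have [nu nuE] := image_measure_exists mu (measurable_mxact L).
have nuH := haarlike_image muL Lu nuE.
have [k0 z0O] := wO x0 wx0; set z0 := tsubN (mxact L x0) (v k0) in z0O.
have [r r0 rw] := ow x0 wx0.
have [d1 d10 d1P] := near_mxact (invmx L) r0.
have near_w z : (forall i, `|tnth z i - tnth z0 i| < d1) ->
    w (mxact (invmx L) (taddN z (v k0))).
  move=> zd; apply: rw => i.
  have -> : mxact (invmx L) (taddN z (v k0)) =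
      taddN x0 (mxact (invmx L) (tsubN z z0)).
    rewrite -{1}[x0](mxactK Lu) -mxactD; congr mxact; apply: eq_tnthP => j.
    by rewrite !(tnth_taddN, tnth_tsubN); ring.
  rewrite tnth_taddN addrC addKr; apply: d1P => j.
  by rewrite tnth_tsubN.
(* This is the j-th term of [A], defined below, at v_k + z0. Over j these terms sum to 1 if k = k0
   and to 0 otherwise. *)
pose c j k := invmx E k0 j * E j k.
have c_sum k : \sum_j c j k = (k == k0)%:R.
  have /matrixP/(_ k0 k) := mulVmx Eunit.
  by rewrite !mxE eq_sym => <-; apply: eq_bigr => j _.
pose alpha j := invmx E k0 j * expi (- dotN (u j) z0).
pose A y := \sum_j alpha j * expi (dotN (u j) y).
pose kap := \sum_j cnorm2 (alpha j).
have kap0 : 0 < kap.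
  rewrite lt_def sumr_ge0 ?andbT => [|j _]; last exact: cnorm2_ge0.
  apply/eqP => kapE; have : \sum_j c j k0 = 0.
    apply: big1 => j _.
    have /eqP := psumr_eq0P (fun j _ => cnorm2_ge0 (alpha j)) kapE (i := j) isT.
    rewrite cnorm2M cnorm2_expi mulr1 cnorm2_eq0 /c => /eqP ->.
    by rewrite mul0r.
  by rewrite c_sum eqxx => /eqP; rewrite oner_eq0.
have V0 := period_cube_gt0 nuH; set V := fine (nu Q) in V0.
(* With this choice [M * eta * I2 n] is at most half of the lower bound [c1 * kap * I2 n / V] that
   the estimate will force. *)
pose eta := c1 * kap / (2 * V * (M%:R + 1)).
have M1 : 0 < M%:R + 1 :> R by rewrite ltr_wpDl.
have eta0 : 0 < eta by rewrite !(divr_gt0, mulr_gt0).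
pose Bc := \sum_k \sum_j cnorm2 (c j k).
have Bc0 : 0 <= Bc.
  by apply: sumr_ge0 => k _; apply: sumr_ge0 => j _; exact: cnorm2_ge0.
have D0 : 0 < 2 * M%:R * Bc + 1 by rewrite ltr_wpDl // !mulr_ge0.
have [tau tau0 tauP] := cos_near0 (divr_gt0 eta0 D0).
have [d2 d20 d2P] := near_dotN_family u tau0.
have A_near z k : k != k0 -> (forall i, `|tnth z i - tnth z0 i| < d2) ->
    cnorm2 (A (taddN z (v k))) <= eta.
  move=> kk0 zd.
  (* For k <> k0 the [c j k] sum to 0, so 1 may be subtracted from each exponential; the differences
     are small near z0. *)
  have -> : A (taddN z (v k)) = \sum_j c j k * (expi (dotN (u j) (tsubN z z0)) - 1).
    under [RHS]eq_bigr do rewrite mulrBr mulr1.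
    rewrite sumrB c_sum (negbTE kk0) subr0; apply: eq_bigr => j _.
    have -> : dotN (u j) (taddN z (v k)) =
        dotN (u j) z0 + dotN (u j) (v k) + dotN (u j) (tsubN z z0).
      rewrite -!dotND; congr dotN; apply: eq_tnthP => i.
      by rewrite !(tnth_taddN, tnth_tsubN); ring.
    have ee : expi (- dotN (u j) z0) * expi (dotN (u j) z0) = 1 :> R[i].
      by rewrite -expiD addNr expi0.
    rewrite /alpha /c !expiD mxE; move: ee.
    move: (invmx _ _ _) (expi (- _)) (expi (dotN (u j) z0)) => a e e' ee.
    move: (expi _) (expi _) => x y.
    by rewrite -[RHS]mul1r -ee; ring.
  apply: le_trans (cnorm2_sum_ord_le _) _.
  have term j : cnorm2 (c j k * (expi (dotN (u j) (tsubN z z0)) - 1)) <=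
      cnorm2 (c j k) * (2 * (eta / (2 * M%:R * Bc + 1))).
    rewrite cnorm2M cnorm2_expi_sub1; apply: ler_wpM2l; first exact: cnorm2_ge0.
    apply: ler_wpM2l => //; apply: tauP; apply: d2P => i.
    by rewrite tnth_tsubN.
  apply: (@le_trans _ _ (M%:R * (Bc * (2 * (eta / (2 * M%:R * Bc + 1)))))).
    apply: ler_wpM2l => //; apply: le_trans (ler_sum _ (fun j _ => term j)) _.
    rewrite -mulr_suml; apply: ler_wpM2r.
      by apply: mulr_ge0 => //; apply: divr_ge0; exact: ltW.
    rewrite /Bc [X in _ <= X](bigD1 k) //= lerDl; apply: sumr_ge0 => l _.
    by apply: sumr_ge0 => j _; exact: cnorm2_ge0.
  have -> : M%:R * (Bc * (2 * (eta / (2 * M%:R * Bc + 1)))) =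
      (2 * M%:R * Bc) * eta / (2 * M%:R * Bc + 1) by ring.
  by rewrite ler_pdivrMr // mulrC; apply: ler_wpM2l; [exact: ltW|rewrite lerDl].
have A_le y : cnorm2 (A y) <= M%:R * kap.
  apply: le_trans (cnorm2_sum_ord_le _) _; apply: ler_wpM2l => //.
  by apply: ler_sum => j _; rewrite cnorm2M cnorm2_expi mulr1.
(* The distance from z0 to the boundary of the cube, capped at 1. It keeps the points of the cube
   away from the periodic copies of z0. *)
pose dz := \big[Num.min/1]_(i < N) Num.min (tnth z0 i) (2 * pi - tnth z0 i).
have dz0 : 0 < dz.
  apply: lt_bigmin => // i _; have /andP[? ?] := z0O i.
  by rewrite lt_min subr_gt0; apply/andP.
have dzP i : dz <= tnth z0 i /\ dz <= 2 * pi - tnth z0 i.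
  have : dz <= Num.min (tnth z0 i) (2 * pi - tnth z0 i) by exact: bigmin_le.
  by rewrite le_min => /andP.
have pi0 : 0 < pi :> R := pi_gt0 R.
(* The bounds serve, in order, to stay inside the removed set, to keep [A] small, to have cos delta
   >= 0, and to apply [cos_far]. *)
have [delta [delta0 dd1 dd2 ddp ddz]] : exists delta : R,
    [/\ 0 < delta, delta <= d1, delta <= d2, delta <= pi / 2 & delta <= dz].
  exists (Num.min (Num.min d1 d2) (Num.min (pi / 2) dz)).
  by rewrite !lt_min d10 d20 dz0 divr_gt0 // !ge_min !lexx ?orbT.
have cos1 : cos delta < 1.
  rewrite -cos0 ltr_cos //; rewrite in_itv /=; apply/andP; split; lra.
have cosd0 : 0 <= cos delta.
  by apply: cos_ge0_pihalf; apply/andP; split => //; lra.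
(* [q] bounds the bump away from z0; [q'] lies midway between [q] and the maximum 1 + 2 N. *)
pose q : R := 2 * N%:R + cos delta.
pose q' : R := 1 + 2 * N%:R - (1 - cos delta) / 2.
have q0 : 0 <= q by rewrite addr_ge0 // mulr_ge0.
have qq' : q < q' by rewrite /q /q'; lra.
have N1 : 0 < 2 * (N%:R + 1) :> R by rewrite mulr_gt0 // ltr_wpDl.
(* N times this quantity is at most (1 - cos delta) / 2, the loss allowed in [q']. *)
have g0 : 0 < (1 - cos delta) / (2 * (N%:R + 1)) by rewrite divr_gt0 // subr_gt0.
have [d3 d30 d3P] := cos_near0 g0.
pose d4 := Num.min d3 dz.
have d40 : 0 < d4 by rewrite lt_min d30.
(* The half-open cube with lower corner z0 has the positive mass of its translate at the origin and
   lies inside the period cube. *)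
pose Box := (fun x => taddN x [tuple - tnth z0 i | i < N]) @^-1` half_open_cube N d4.
have mBox : measurable Box by apply: measurable_shift; exact: measurable_half_open_cube.
have nuBox : nu Box = nu (half_open_cube N d4).
  by case: nuH => + _ _; apply; exact: measurable_half_open_cube.
have BoxQ : Box `<=` Q.
  move=> z zB i; have := zB i; rewrite tnth_taddN tnth_mktuple => /andP[h1 h2].
  have [_ hz] := dzP i; have /andP[h3 _] := z0O i.
  have h4 : d4 <= dz by rewrite /d4 ge_min lexx orbT.
  by apply/andP; split; lra.
have Qf := period_cube_lty nuH.
have mQ : measurable Q := measurable_half_open_cube _.
have cube0 := half_open_cube_gt0 nuH d40.
have Boxf : (nu (half_open_cube N d4) < +oo)%E.
  by rewrite -nuBox; apply: le_lt_trans Qf; apply: le_measure; rewrite ?inE.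
pose beta := fine (nu (half_open_cube N d4)).
have beta0 : 0 < beta by rewrite fine_gt0 // cube0.
pose I2 n := \int[nu]_(z in Q) (bump z0 z ^+ n) ^+ 2.
have bm2 n : bm (fun z => (bump z0 z ^+ n) ^+ 2) by exact: bmM (bm_bump z0 n) (bm_bump z0 n).
have lower n : (q' ^+ 2) ^+ n * beta <= I2 n.
  rewrite -lee_fin -(EFin_Rintegral mQ Qf) //.
  apply: le_trans (ge0_subset_integral nu mBox mQ _ _ BoxQ); last first.
  - by move=> z _; rewrite lee_fin sqr_ge0.
  - by apply/measurable_EFinP; apply: measurable_funTS; case: (bm2 n).
  rewrite EFinM fineK ?ge0_fin_numE // -nuBox -integral_cst //.
  apply: ge0_le_integral => //.
  - by move=> z _; rewrite lee_fin; apply: exprn_ge0; exact: sqr_ge0.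
  - by apply/measurable_EFinP; apply: measurable_funTS; case: (bm2 n).
  move=> z zB; rewrite lee_fin exprAC.
  have q'0 : 0 <= q' by apply: ltW; exact: le_lt_trans qq'.
  rewrite lerXn2r ?nnegrE ?exprn_ge0 ?bump_ge0 // lerXn2r ?nnegrE ?bump_ge0 //.
  have zd i : 1 - cos (tnth z i - tnth z0 i) <= (1 - cos delta) / (2 * (N%:R + 1)).
    apply: d3P; have := zB i; rewrite tnth_taddN tnth_mktuple => /andP[h1 h2].
    by rewrite ger0_norm //; apply: lt_le_trans h2 _; rewrite /d4 ge_min lexx.
  apply: le_trans (bump_near zd); rewrite /q' lerD2l lerN2.
  rewrite mulrA ler_pdivrMr //.
  have -> : (1 - cos delta) / 2 * (2 * (N%:R + 1)) = (1 - cos delta) * (N%:R + 1) by field.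
  rewrite mulrC; apply: ler_wpM2l; last by rewrite lerDl.
  by rewrite subr_ge0 ltW.
have upper n (s : seq I) (b : I -> R[i]) :
    (forall y, exp_sum u s b y = A y * (bump z0 y ^+ n)%:C%C) ->
    (\int[mu]_(x in Omega L v `\` w) (cnorm2 (exp_sum u s b (mxact L x)))%:E <=
      (M%:R * (eta * I2 n + M%:R * kap * (q ^+ 2) ^+ n * V))%:E)%E.
  (* The first term covers the points where [A] is small, the second those where the bump is at most
     [q]. Being periodic, [K] folds to M copies of itself. *)
  move=> sE; pose K y := eta * (bump z0 y ^+ n) ^+ 2 + M%:R * kap * (q ^+ 2) ^+ n.
  have Mq0 : 0 <= M%:R * kap * (q ^+ 2) ^+ n.
    by apply: mulr_ge0; [apply: mulr_ge0 => //; exact: ltW|apply: exprn_ge0; exact: sqr_ge0].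
  have bK : bm K by apply: bmD; [apply: bmM => //|]; exact: bm_cst.
  have K0 y : 0 <= K y.
    apply: addr_ge0; first by apply: mulr_ge0; [exact: ltW|exact: sqr_ge0].
    exact: Mq0.
  have mO : measurable (Omega L v) by exact: measurable_Omega.
  have mOw : measurable (Omega L v `\` w).
    by apply: measurableD => //; exact: measurable_openN.
  have mL (D : set T) (h : T -> R) : bm h ->
      measurable_fun D (fun x => (h (mxact L x))%:E).
    move=> [mh _]; apply/measurable_EFinP; apply: measurable_funTS.
    by apply: measurableT_comp => //; exact: measurable_mxact.
  apply: (@le_trans _ _ (\int[mu]_(x in Omega L v) (K (mxact L x))%:E)%E).
    apply: le_trans (ge0_subset_integral mu mOw mO _ _ (@subDsetl _ _ _)); last first.
    - by move=> x _; rewrite lee_fin.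
    - exact: mL.
    apply: ge0_le_integral => //.
    - by move=> x _; rewrite lee_fin cnorm2_ge0.
    - exact: (mL _ _ (bm_cnorm2 (cbm_exp_sum u s b))).
    - exact: mL.
    move=> x [[k xk] nwx]; rewrite lee_fin sE cnorm2M cnorm2_real.
    set y := mxact L x; set z := tsubN y (v k) in xk.
    have yz : y = taddN z (v k) by rewrite taddNC tsubNK.
    have bumpE : bump z0 y = bump z0 z by rewrite yz bump_shift.
    have [zd|] := pselect (forall i, `|tnth z i - tnth z0 i| < delta).
      (* Points this close to v_k0 + z0 come from the removed set. *)
      have kk0 : k != k0.
        apply/eqP => kk0; apply: nwx; rewrite -[x](mxactK Lu) -/y yz kk0.
        by apply: near_w => i; exact: lt_le_trans (zd i) dd1.
      rewrite /K; apply: ler_wpDr; first exact: Mq0.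
      apply: ler_wpM2r; first exact: sqr_ge0.
      by rewrite yz; apply: A_near => // i; exact: lt_le_trans (zd i) dd2.
    move=> /existsNP[i /negP]; rewrite -leNgt => zd.
    rewrite /K; apply: ler_wpDl; first by apply: mulr_ge0; [exact: ltW|exact: sqr_ge0].
    apply: ler_pM; [exact: cnorm2_ge0|exact: sqr_ge0|exact: A_le|].
    rewrite exprAC lerXn2r ?nnegrE ?exprn_ge0 ?bump_ge0 // lerXn2r ?nnegrE ?bump_ge0 //.
    rewrite bumpE; apply: (bump_far (i := i)); apply: cos_far.
      by apply/andP; split; [exact: ltW|lra].
    apply/andP; split => //; rewrite ler_norml.
    have /andP[h1 h2] := xk i; have [h3 h4] := dzP i; have /andP[h5 h6] := z0O i.
    by apply/andP; split; lra.
  have <- : (\int[nu]_(y in shifted_cubes v) (K y)%:E =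
      \int[mu]_(x in Omega L v) (K (mxact L x))%:E)%E.
    rewrite nuE ge0_integral_pushforward //.
    - exact: measurable_mxact.
    - exact: (measurable_shifted_cubes v).
    - by apply/measurable_EFinP; apply: measurable_funTS; case: bK.
    - by move=> y _; rewrite lee_fin.
  rewrite (integral_shifted_cubes nuH v2pi Eunit); last 2 first.
  - by apply/measurable_EFinP; case: bK.
  - by move=> y; rewrite lee_fin.
  rewrite (eq_integral (fun z => (M%:R * K z)%:E)) => [|z _]; last first.
    rewrite /= sumEFin (eq_bigr (fun=> K z)) => [|k _].
      by rewrite sumr_const card_ord mulr_natl.
    by rewrite /K bump_shift.
  rewrite (EFin_Rintegral mQ Qf); last by apply: bmM => //; exact: bm_cst.
  rewrite lee_fin RintegralZl //; last exact: bm_integrable.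
  apply: ler_wpM2l => //.
  rewrite /K RintegralD //; last 2 first.
  - by apply: bm_integrable => //; apply: bmM => //; exact: bm_cst.
  - by apply: bm_integrable => //; exact: bm_cst.
  rewrite RintegralZl //; last exact: bm_integrable.
  by rewrite Rintegral_cst.
have A0 : 0 < c1 * kap / (2 * V) * beta by rewrite !(divr_gt0, mulr_gt0).
have q2 : q ^+ 2 < q' ^+ 2.
  by rewrite ltrXn2r ?nnegrE //; apply: ltW; exact: le_lt_trans qq'.
(* [eta] and [delta] are already fixed; a large power now makes the contribution away from z0
   smaller than the other half of the lower bound. *)
have [n nP] := geometric_gap (M%:R * (M%:R * kap * V)) (sqr_ge0 q) q2 A0.
have [s [b [us bP]]] := trig_poly_uniq (trig_poly_bump z0 n).
pose ss : seq I := [seq (j, m) | j <- enum 'I_M, m <- s].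
pose bb (p : I) := alpha p.1 * b p.2.
have uss : uniq ss.
  by apply: allpairs_uniq => //; [exact: enum_uniq|move=> [? ?] [? ?]].
have ssE y : exp_sum u ss bb y = A y * (bump z0 y ^+ n)%:C%C.
  rewrite bP /exp_sum big_allpairs_dep big_enum /= /A mulr_suml; apply: eq_bigr => j _.
  rewrite mulr_sumr; apply: eq_bigr => m _.
  by rewrite /bb /freq /= dotNDl expiD mulrACA.
have bbE : V * \sum_(p <- ss) cnorm2 (bb p) = kap * I2 n.
  rewrite big_allpairs_dep big_enum /= /I2.
  rewrite (@eq_Rintegral _ _ _ nu Q (fun z => cnorm2 (\sum_(m <- s) b m * expi (dotN (intv m) z)))).
    rewrite parseval // mulrCA; congr (_ * _); rewrite /kap mulr_suml.
    apply: eq_bigr => j _; rewrite mulr_sumr; apply: eq_bigr => m _.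
    by rewrite /bb cnorm2M.
  by move=> z _; rewrite -bP cnorm2_real.
have mOw : measurable (Omega L v `\` w).
  by apply: measurableD; [exact: measurable_Omega|exact: measurable_openN].
have := le_trans (two_sided_estimate_exp_sum bb mOw c10 est uss) (upper n ss bb ssE).
rewrite lee_fin.
have -> : \sum_(p <- ss) cnorm2 (bb p) = kap * I2 n / V.
  by rewrite -bbE mulrC mulKf // gt_eqF.
have I20 : 0 <= I2 n by apply: Rintegral_ge0 => z _; exact: sqr_ge0.
have Meta : M%:R * eta * I2 n <= c1 * kap / (2 * V) * I2 n.
  apply: ler_wpM2r => //.
  have -> : eta = c1 * kap / (2 * V) / (M%:R + 1) by rewrite /eta invfM mulrA.
  rewrite mulrA ler_pdivrMr // mulrC; apply: ler_wpM2l.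
    by apply: divr_ge0; rewrite ltW ?mulr_gt0.
  by rewrite lerDl.
have lown : c1 * kap / (2 * V) * beta * (q' ^+ 2) ^+ n <= c1 * kap / (2 * V) * I2 n.
  rewrite -mulrA; apply: ler_wpM2l; last by rewrite mulrC lower.
  by apply: divr_ge0; rewrite ltW ?mulr_gt0.
(* The lower bound is twice a quantity that bounds each of the two contributions from above, the
   second one strictly. *)
have -> : c1 * (kap * I2 n / V) = 2 * (c1 * kap / (2 * V) * I2 n).
  by field; rewrite gt_eqF.
by move: Meta lown nP; lra.
Qed.

End Removal.

Unset Implicit Arguments.
Set Strict Implicit.

Theorem theorem2p2 (R : realType) (N M : nat)
    (u v : 'I_M -> N.-tuple R) (L : 'M[R]_N)
    (mu : {measure set (N.-tuple R) -> \bar R}) :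
  is_lebesgue_measureN mu ->
  L \in unitmx ->
  (* the translates u_j + Z^N are pairwise disjoint *)
  (forall j k : 'I_M, j != k -> int_translate (u j) `&` int_translate (u k) = set0) ->
  (* (A1) *)
  (forall (k : 'I_M) (i : 'I_N), exists z : int, tnth (v k) i = 2 * pi * z%:~R) ->
  (* (A2) *)
  (\matrix_(j < M, k < M) expi (dotN (u j) (v k))) \in unitmx ->
  (* (i) *)
  ((forall a : N.-tuple R -> R[i], square_summable (Lambda L u) a ->
      exists f, L2_exp_sum mu (Omega L v) (Lambda L u) a f) /\
   exists c1 c2 : R, [/\ 0 < c1, 0 < c2 &
      two_sided_estimate mu (Omega L v) (Lambda L u) c1 c2]) /\
  (* (ii) *)
  (forall w : set (N.-tuple R), is_openN w -> w !=set0 -> w `<=` Omega L v ->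
     ~ exists c1 c2 : R, [/\ 0 < c1, 0 < c2 &
         two_sided_estimate mu (Omega L v `\` w) (Lambda L u) c1 c2]).
Proof.
move=> muL Lu u_disj v2pi Eunit.
have [c1 [c2 [c10 c20 bounds]]] := riesz_bounds muL Lu u_disj v2pi Eunit.
have mO : measurable (Omega L v) by exact: measurable_Omega.
have Ofin := Omega_lty muL Lu v2pi Eunit.
split; [split|].
- by move=> a sa; exact: (L2_exp_sum_exists mO Ofin c20 bounds sa).
- exists (c1 / 2), (2 * c2); split; rewrite ?divr_gt0 ?mulr_gt0 //.
  exact: (two_sided_estimate_of_bounds mO c10 c20 bounds).
- move=> w ow w0 wO [d1 [d2 [d10 _ est]]].
  exact: (two_sided_estimate_removal muL Lu u_disj v2pi Eunit ow w0 wO d10 est).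
Qed.
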